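(* In the setting below, if the $\tilde P$-$s$ chain is locally-$s$-recurrent, then the $P$-$\nu$ chain is locally-$\nu$-recurrent.
   Context: $(\mathcal{X},\mathcal{B})$ and $(\Theta,\mathcal{C})$ are Polish spaces with Borel $\sigma$-algebras; $P(\cdot\mid\theta)$ is a Markov kernel; $\nu$ is a $\sigma$-finite measure on $\Theta$; the marginal $M(B)=\int P(B\mid\theta)\nu(d\theta)$ is $\sigma$-finite; $Q(d\theta\mid x)$ is a Markov kernel with $P(dx\mid\theta)\nu(d\theta)=Q(d\theta\mid x)M(dx)$. The $P$-$\nu$ chain is the Markov chain on $\Theta$ with transition $R(C\mid\eta)=\int Q(C\mid x)P(dx\mid\eta)$. Let $t:\Theta\to[0,\infty)$ be measurable and $s(A)=\nu(t^{-1}(A))$. Assume there are disjoint Borel sets $A_i$, $i\ge1$, covering $[0,\infty)$ with $0<\nu(t^{-1}(A_i))<\infty$. Let $\pi(d\theta\mid a)$ be a Markov kernel with $\int f_2(t(\theta))f_1(\theta)\nu(d\theta)=\int_0^\infty f_2(a)\int f_1(\theta)\pi(d\theta\mid a)\,s(da)$ for all nonnegative measurable $f_1,f_2$. Set $\tilde P(dx\mid a)=\int P(dx\mid\theta)\pi(d\theta\mid a)$ and let $\tilde Q(da\mid x)$ satisfy $\tilde P(dx\mid a)s(da)=\tilde Q(da\mid x)M(dx)$. The $\tilde P$-$s$ chain is the Markov chain on $[0,\infty)$ with transition $\tilde R(da\mid b)=\int\tilde Q(da\mid x)\tilde P(dx\mid b)$. For a Markov chain $W=(W_0,W_1,\dots)$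 on a space with $\sigma$-finite measure $\mu$: a measurable set $C$ is $\mu$-proper if $0<\mu(C)<\infty$; $\tau_C$ is the first $n\ge1$ with $W_n\in C$ ($\infty$ if none) and $E_C=\{\tau_C<\infty\}$; a $\mu$-proper $C$ is locally-$\mu$-recurrent if $\{w_0\in C: P_{w_0}(E_C)<1\}$ has $\mu$-measure zero, where $P_{w_0}$ is the law of the chain started at $w_0$; the chain is locally-$\mu$-recurrent if every $\mu$-proper set is locally-$\mu$-recurrent. *)

(* Defs.v *)
From HB Require Import structures.
From mathcomp Require Import all_boot all_order all_algebra.
From mathcomp Require Import all_classical all_reals all_analysis.
From mathcomp Require Import measurable_realfun.
Set Implicit Arguments. Unset Strict Implicit. Unset Printing Implicit Defensive.
Import Order.TTheory GRing.Theory Num.Theory.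
Local Open Scope classical_set_scope.
Local Open Scope ring_scope.

Section Defs.
Context {R : realType}.

Definition is_metric {T : Type} (dist : T -> T -> R) : Prop :=
  [/\ (forall x y, 0 <= dist x y),
      (forall x y, dist x y = 0 <-> x = y),
      (forall x y, dist x y = dist y x) &
      (forall x y z, dist x z <= dist x y + dist y z)].

Definition metric_open {T : Type} (dist : T -> T -> R) (A : set T) : Prop :=
  forall x, A x -> exists e, 0 < e /\ [set y | dist x y < e] `<=` A.

Definition metric_complete {T : Type} (dist : T -> T -> R) : Prop :=
  forall u : nat -> T,
    (forall e, 0 < e -> exists N, forall m n, (N <= m)%N -> (N <= n)%N ->
        dist (u m) (u n) < e) ->
    exists l, forall e, 0 < e -> exists N, forall n, (N <= n)%N -> dist (u n) l < e.

Definition metric_separable {T : Type} (dist : T -> T -> R) : Prop :=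
  exists D : set T, countable D /\
    forall x e, 0 < e -> exists y, D y /\ dist x y < e.

Definition polish_borel {d} (X : measurableType d) : Prop :=
  exists dist : X -> X -> R,
    [/\ is_metric dist, metric_complete dist, metric_separable dist &
        forall A : set X, measurable A <-> <<s metric_open dist >> A].

(** Markov chains.  [W] is a realization, on the probability space [P], of
    the Markov chain with transition [K] started at [w0]: [W 0 = w0] and the
    Markov property holds on all cylinder sets. *)
Definition mc_realization {dS} {S : measurableType dS} {dO}
    {Om : measurableType dO} (P : probability Om R)
    (K : S -> set S -> \bar R) (w0 : S) (W : nat -> Om -> S) : Prop :=
  [/\ (forall n, measurable_fun setT (W n)),
      (forall om, W 0%N om = w0) &
      (forall (n : nat) (A : nat -> set S) (B : set S),
         (forall k, measurable (A k)) -> measurable B ->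
         P (\bigcap_(k in [set k | (k <= n)%N]) (W k @^-1` A k) `&` W n.+1 @^-1` B)
         = (\int[P]_(om in \bigcap_(k in [set k | (k <= n)%N]) (W k @^-1` A k))
              K (W n om) B)%E)].

Definition hit_event {dS} {S : measurableType dS} {Om : Type}
    (W : nat -> Om -> S) (C : set S) : set Om :=
  [set om | exists n : nat, C (W n.+1 om)].

Definition mu_proper {dS} {S : measurableType dS}
    (mu : {measure set S -> \bar R}) (C : set S) : Prop :=
  [/\ measurable C, (0 < mu C)%E & (mu C < +oo)%E].

Definition locally_recurrent_set {dS} {S : measurableType dS}
    (mu : {measure set S -> \bar R}) (K : S -> set S -> \bar R) (C : set S) : Prop :=
  mu_proper mu C /\
  mu.-negligible [set w0 | C w0 /\
     exists (dO : measure_display) (Om : measurableType dO)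
            (P : probability Om R) (W : nat -> Om -> S),
       mc_realization P K w0 W /\ (P (hit_event W C) < 1)%E].

Definition locally_recurrent_on {dS} {S : measurableType dS} (D : set S)
    (mu : {measure set S -> \bar R}) (K : S -> set S -> \bar R) : Prop :=
  forall C, C `<=` D -> mu_proper mu C -> locally_recurrent_set mu K C.

End Defs.

(* Main.v *)
Require Import Defs.
From HB Require Import structures.
From mathcomp Require Import all_boot all_order all_algebra.
From mathcomp Require Import all_classical all_reals all_analysis.
From mathcomp Require Import measurable_realfun.
From mathcomp Require Import lra ring.
Set Implicit Arguments. Unset Strict Implicit. Unset Printing Implicit Defensive.
Import Order.TTheory GRing.Theory Num.Theory.
Import numFieldNormedType.Exports.
Local Open Scope classical_set_scope.
Local Open Scope ring_scope.

(* Both chains are reversible, with a transition factoring through X: the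
   Dirichlet form of the P-nu chain is E(g) = |g|^2 - |Qg|^2, with norms in
   L2(nu) and L2(M).  Let h_n be the probability of meeting a set C at one of the
   times 0, ..., n and v_n that of avoiding C at times 1, ..., n.  From
   h_(n+1) = R h_n + 1_C v_(n+1) one gets E(h_n) <= int_C v_(n+1), and, by
   positivity of E(h_n - c g) for a g equal to 1 on D,
     2 c int_(C & D) v_(n+1)
       <= mu(C) + c^2 E(g) + 2 c (int h_(n+1) g - int h_n g).
   Hence C is recurrent on D as soon as there are such g with E(g) arbitrarily
   small.  For the lumped chain, recurrence of A_i makes E(h_n) tend to 0;
   the functions h_n o t are equal to 1 on t^-1(A_i) and have the same energy for
   the P-nu chain, and the sets t^-1(A_i) cover Theta.
   Recurrence being stated through realizations of the chain, one must also show
   that the lumped chain has a realization: a uniform variable, split into two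
   independent ones by its even and odd binary digits, drives each transition
   through the quantile function of the kernel. *)

(** * Mixtures of measures *)

Section mixture.
Local Open Scope ereal_scope.
Context d2 (Z : measurableType d2) (R : realType).
Import HBNNSimple.

Section one_side.
Context d1 (Y : measurableType d1).
Variables (mu : {measure set Y -> \bar R}) (D : set Y)
  (k : Y -> {measure set Z -> \bar R}).
Hypothesis mD : measurable D.
Hypothesis mk : forall U, measurable U -> measurable_fun setT (k ^~ U).

Let mixture_nnsfun (f : {nnsfun Z >-> R}) :
  \int[mu]_(y in D) \int[k y]_z (f z)%:E =
  \sum_(r \in range f) r%:E * \int[mu]_(y in D) k y (f @^-1` [set r]).
Proof.
under eq_integral do rewrite integralT_nnsfun sintegralE.
rewrite ge0_integral_fsum//; first last.
- move=> r y _; exact: nnsfun_mulemu_ge0.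
- move=> r; apply: measurable_funeM.
  by apply: measurable_funTS; exact: mk.
apply: eq_fsbigr => r /[!inE] -[z _ <-].
rewrite ge0_integralZl//.
- by apply: measurable_funTS; exact: mk.
- by rewrite lee_fin.
Qed.

(** The right-hand side sees [mu] and [k] only through the set function that sends U to the integral
    of [k y U]. Two mixtures agreeing on sets therefore agree on nonnegative functions. *)
Lemma mixture_limE (f : Z -> \bar R) (mf : measurable_fun setT f) :
  (forall z, 0 <= f z) -> \int[mu]_(y in D) \int[k y]_z f z =
  limn (fun n => \sum_(r \in range (nnsfun_approx measurableT mf n))
    r%:E * \int[mu]_(y in D) k y (nnsfun_approx measurableT mf n @^-1` [set r])).
Proof.
move=> f0; set f_ := nnsfun_approx measurableT mf.
have f_lim z : f z = lim ((f_ n z)%:E @[n --> \oo]).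
  by apply/esym/cvg_lim => //=; exact: cvg_nnsfun_approx.
have f_nd z : {homo (fun i => (f_ i z)%:E) : a b / (a <= b)%N >-> a <= b}.
  by move=> a b ab; rewrite lee_fin; exact/lefP/nd_nnsfun_approx.
have mf_ n : measurable_fun setT (EFin \o f_ n) by exact/measurable_EFinP.
have lim_int (m' : {measure set Z -> \bar R}) :
    \int[m']_z f z = lim (\int[m']_z (f_ n z)%:E @[n --> \oo]).
  rewrite -monotone_convergence//.
  - by apply: eq_integral => z _; exact: f_lim.
  - by move=> ? z _; rewrite lee_fin.
transitivity (limn (fun n => \int[mu]_(y in D) \int[k y]_z (f_ n z)%:E)); last first.
  by congr (limn _); apply/funext => n; exact: mixture_nnsfun.
rewrite -monotone_convergence//.
- by apply: eq_integral => y _; rewrite lim_int.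
- move=> n; apply: measurable_funTS; apply: measurable_fun_integral_kernel => //.
  + by move=> z; rewrite lee_fin.
  + exact: mf_.
- by move=> n y _; apply: integral_ge0 => z _; rewrite lee_fin.
- move=> y _ a b ab; apply: ge0_le_integral => //.
  + by move=> z _; rewrite lee_fin.
  + exact: mf_.
  + exact: mf_.
  + by move=> z _; exact: f_nd.
Qed.

End one_side.

Lemma eq_integral_mixture d1 d1' (Y : measurableType d1) (Y' : measurableType d1')
    (mu : {measure set Y -> \bar R}) (D : set Y) (k : Y -> {measure set Z -> \bar R})
    (mu' : {measure set Y' -> \bar R}) (D' : set Y')
    (k' : Y' -> {measure set Z -> \bar R}) (f : Z -> \bar R) :
  measurable D -> (forall U, measurable U -> measurable_fun setT (k ^~ U)) ->
  measurable D' -> (forall U, measurable U -> measurable_fun setT (k' ^~ U)) ->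
  (forall B, measurable B ->
    \int[mu]_(y in D) k y B = \int[mu']_(y in D') k' y B) ->
  measurable_fun setT f -> (forall z, 0 <= f z) ->
  \int[mu]_(y in D) \int[k y]_z f z = \int[mu']_(y in D') \int[k' y]_z f z.
Proof.
move=> mD mk mD' mk' e mf f0; rewrite !(mixture_limE _ _ _ mf)//.
by congr (limn _); apply/funext => n; apply: eq_fsbigr => r _; rewrite e.
Qed.

(** The measure [m] is itself a mixture, of Dirac masses, which reduces the claim to the comparison
    of two mixtures. *)
Lemma ge0_integral_mixture d1 (Y : measurableType d1)
    (mu : {measure set Y -> \bar R}) (k : Y -> {measure set Z -> \bar R})
    (m : {measure set Z -> \bar R}) (f : Z -> \bar R) :
  (forall U, measurable U -> measurable_fun setT (k ^~ U)) ->
  (forall B, measurable B -> m B = \int[mu]_y k y B) ->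
  measurable_fun setT f -> (forall z, 0 <= f z) ->
  \int[m]_z f z = \int[mu]_y \int[k y]_z f z.
Proof.
move=> mk e mf f0.
rewrite -(eq_integral_mixture (mu := m) (D := setT) (k := fun z => \d_z) _ _ measurableT mk _ mf f0)//.
- by apply: eq_integral => z _; rewrite integral_dirac// diracT mul1e.
- move=> U mU; exact: measurable_fun_dirac.
- by move=> B mB; rewrite -e// -[in RHS](setIT B) -integral_indic.
Qed.

End mixture.

(** * Functions with values in the unit interval *)

Section unit_functions.
Context d (T : measurableType d) (R : realType).
Implicit Types (f g : T -> R) (mu : {measure set T -> \bar R}).

(** All functions met below are probabilities. The bounds make every integral against a probability
    kernel finite, so that real-valued integrals and ordinary arithmetic can be used. *)
Definition ufun f := measurable_fun setT f /\ forall x, 0 <= f x <= 1.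

Lemma ufunM f g : ufun f -> ufun g -> ufun (fun x => f x * g x).
Proof.
move=> [mf f01] [mg g01]; split; first exact: measurable_funM.
by move=> x; have := f01 x; have := g01 x => /andP[? ?] /andP[? ?]; apply/andP; split; nra.
Qed.

Lemma ufun_onem f : ufun f -> ufun (fun x => 1 - f x).
Proof.
move=> [mf f01]; split; first exact: measurable_funB.
by move=> x; have := f01 x; lra.
Qed.

Lemma ufun_cst1 : ufun (fun=> 1).
Proof. by split => // x; rewrite ler01 lexx. Qed.

Lemma ufun_indic (A : set T) : measurable A -> ufun (\1_A).
Proof.
move=> mA; split; first exact: measurable_indic.
by move=> x; rewrite indicE; case: (_ \in _); rewrite ?lexx ?ler01.
Qed.

Definition ufun1 (mu : {measure set T -> \bar R}) f :=
  ufun f /\ mu.-integrable setT (EFin \o f).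

Lemma ufun1M mu f g : ufun f -> ufun1 mu g -> ufun1 mu (fun x => f x * g x).
Proof.
move=> uf [ug ig]; have ufg := ufunM uf ug; split => //.
apply: le_integrable ig => //; first by apply/measurable_EFinP; case: ufg.
move=> x _ /=; rewrite lee_fin.
have := uf.2 x; have := ug.2 x => /andP[g0 g1] /andP[f0 f1].
by rewrite !ger0_norm ?mulr_ge0// ler_piMl.
Qed.

Lemma ufun1_sqr mu f : ufun1 mu f -> ufun1 mu (fun x => f x ^+ 2).
Proof. by move=> [uf fi]; exact: ufun1M. Qed.

Lemma ufun1_finite mu f : mu setT = 1%E -> ufun f -> ufun1 mu f.
Proof.
move=> mu1 [mf f01]; split => //; apply: measurable_bounded_integrable => //.
  by rewrite mu1 ltry.
exists 1; split => // M M1 x _ /=.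
by have /andP[f0 f1] := f01 x; rewrite ger0_norm// (le_trans f1)// ltW.
Qed.

Lemma ufun1_indic mu (A : set T) :
  measurable A -> (mu A < +oo)%E -> ufun1 mu (\1_A).
Proof.
move=> mA Aoo; split; first exact: ufun_indic.
apply/integrableP; split; first exact/measurable_EFinP.
under eq_integral do rewrite gee0_abs ?lee_fin//.
by rewrite integral_indic// setIT.
Qed.

Lemma ufun1D mu f g : ufun1 mu f -> ufun1 mu g -> ufun (fun x => f x + g x) ->
  ufun1 mu (fun x => f x + g x).
Proof. move=> [_ fi] [_ gi] ufg; split => //.
exact: (integrableD measurableT fi gi). Qed.

End unit_functions.
Arguments ufun_indic {d T R A}.

(** * Nonnegativity of a variance *)

Section mean_form.
Context d (T : measurableType d) (R : realType) (mu : {measure set T -> \bar R}).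
Hypothesis mu1 : mu setT = 1%E.
Local Notation mean f := (\int[mu]_x f x).

(** This is the variance of h - c g being nonnegative, with the square expanded and the terms sorted
    by sign. *)
Lemma mean_form (h g : T -> R) (c : R) : ufun h -> ufun g ->
  2 * c * mean (fun x => h x * g x) + mean h ^+ 2 + c ^+ 2 * mean g ^+ 2 <=
  mean (fun x => h x ^+ 2) + c ^+ 2 * mean (fun x => g x ^+ 2)
  + 2 * c * (mean h * mean g).
Proof.
move=> uh ug.
have int f : ufun f -> mu.-integrable setT (EFin \o f).
  by move=> uf; case: (ufun1_finite mu1 uf).
have intZ r f : mu.-integrable setT (EFin \o f) ->
    mu.-integrable setT (EFin \o (fun x => r * f x)).
  by move=> fi; exact: (integrableZl measurableT _ fi).
have intD f1 f2 : mu.-integrable setT (EFin \o f1) ->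
    mu.-integrable setT (EFin \o f2) ->
    mu.-integrable setT (EFin \o (fun x => f1 x + f2 x)).
  by move=> f1i f2i; exact: (integrableD measurableT f1i f2i).
have ih := int _ uh; have ig := int _ ug; have ihg := int _ (ufunM uh ug).
have ihh : mu.-integrable setT (EFin \o (fun x => h x ^+ 2)) := int _ (ufunM uh uh).
have igg : mu.-integrable setT (EFin \o (fun x => g x ^+ 2)) := int _ (ufunM ug ug).
(* [a] is the mean of h - c g and [b] its square; the existentials keep both opaque until the final
   arithmetic. *)
have [a aE] : exists a, a = mean h - c * mean g by eexists.
have [b bE] : exists b, b = a ^+ 2 by eexists.
have ic : mu.-integrable setT (EFin \o (fun=> b)).
  have := intZ b _ (int _ (@ufun_cst1 _ T R)).
  by under eq_fun do rewrite mulr1.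
have : 0 <= mean (fun x => (h x - c * g x - a) ^+ 2).
  by apply: Rintegral_ge0 => x _; exact: sqr_ge0.
under eq_Rintegral => x _.
  rewrite (_ : (_ ^+ 2) = h x ^+ 2 + (c ^+ 2 * g x ^+ 2 +
    ((- 2 * c) * (h x * g x) + ((- 2 * a) * h x + ((2 * a * c) * g x + b)))));
    last by rewrite bE; ring.
  over.
have i1 := intD _ _ (intZ (2 * a * c) _ ig) ic.
have i2 := intD _ _ (intZ (- 2 * a) _ ih) i1.
have i3 := intD _ _ (intZ (- 2 * c) _ ihg) i2.
have i4 := intD _ _ (intZ (c ^+ 2) _ igg) i3.
rewrite !(RintegralD, RintegralZl, Rintegral_cst)//; try exact: intZ.
rewrite mu1 /= mulr1 bE aE; lra.
Qed.

End mean_form.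

(** * Kernels as operators and the Dirichlet form *)

Section kmean.
Context dX dY (X : measurableType dX) (Y : measurableType dY) (R : realType).
Variable k : R.-pker X ~> Y.
Implicit Types f g : Y -> R.

Definition kmean f x : R := \int[k x]_y f y.

Let integrable_ufun f x : ufun f -> (k x).-integrable setT (EFin \o f).
Proof.
by move=> uf; case: (@ufun1_finite _ _ _ (k x) f _ uf) => //; exact: prob_kernel.
Qed.

Lemma kmeanE f x : ufun f -> (kmean f x)%:E = (\int[k x]_y (f y)%:E)%E.
Proof.
move=> uf; rewrite /kmean /Rintegral fineK//.
exact: (integrable_fin_num measurableT (integrable_ufun x uf)).
Qed.

Lemma kmean_cst r x : kmean (fun=> r) x = r.
Proof.
by rewrite /kmean Rintegral_cst//; rewrite prob_kernel mulr1.
Qed.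

Lemma kmean_le f g x : ufun f -> ufun g -> (forall y, f y <= g y) ->
  kmean f x <= kmean g x.
Proof. by move=> uf ug fg; apply: le_Rintegral => //; exact: integrable_ufun. Qed.

Lemma kmean_onem f x : ufun f -> kmean (fun y => 1 - f y) x = 1 - kmean f x.
Proof.
move=> uf; rewrite /kmean RintegralB//; last exact: integrable_ufun.
  by rewrite -/(kmean (fun=> 1) x) kmean_cst.
exact: integrable_ufun (@ufun_cst1 _ Y R).
Qed.

Lemma ufun_kmean f : ufun f -> ufun (kmean f).
Proof.
move=> uf; split.
  apply/measurable_EFinP; rewrite (_ : _ \o _ = fun x => (\int[k x]_y (f y)%:E)%E).
    apply: measurable_fun_integral_kernel.
    - exact: measurable_kernel.
    - by move=> y; rewrite lee_fin; case/andP: (uf.2 y).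
    - by apply/measurable_EFinP; case: uf.
  by apply/funext => x; rewrite /= kmeanE.
move=> x; apply/andP; split.
  by apply: Rintegral_ge0 => y _; case/andP: (uf.2 y).
rewrite -(kmean_cst 1 x); apply: kmean_le => //; first exact: ufun_cst1.
by move=> y; case/andP: (uf.2 y).
Qed.

End kmean.

Section reversible.
Context dT dX (T : measurableType dT) (X : measurableType dX) (R : realType).
Variables (P : R.-pker T ~> X) (Q : R.-pker X ~> T).
Variables (nu : {measure set T -> \bar R}) (M : {measure set X -> \bar R}).
Hypothesis PQ : forall f : X * T -> \bar R, measurable_fun setT f ->
  (forall z, 0 <= f z)%E ->
  (\int[nu]_th \int[P th]_x f (x, th) = \int[M]_x \int[Q x]_th f (x, th))%E.

(** The two kernels are adjoint operators between L2(nu) and L2(M): [PQ] is applied to the function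
    phi(x) g(th), and the factor that does not depend on the inner variable is pulled out on each
    side. *)
Lemma ge0_kmean_adjoint (phi : X -> R) (g : T -> R) : ufun phi -> ufun g ->
  (\int[nu]_th (g th * kmean P phi th)%:E = \int[M]_x (phi x * kmean Q g x)%:E)%E.
Proof.
move=> uphi ug.
have mf : measurable_fun setT (fun z : X * T => (phi z.1 * g z.2)%:E).
  apply/measurable_EFinP; apply: measurable_funM.
  - by apply: (measurableT_comp uphi.1); exact: measurable_fst.
  - by apply: (measurableT_comp ug.1); exact: measurable_snd.
have f0 (z : X * T) : (0 <= (phi z.1 * g z.2)%:E)%E.
  have /andP[? _] := uphi.2 z.1; have /andP[? _] := ug.2 z.2.
  by rewrite lee_fin mulr_ge0.
have := PQ mf f0 => /= e.
transitivity (\int[nu]_th \int[P th]_x (phi x * g th)%:E)%E; last first.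
  rewrite e; apply: eq_integral => x _.
  under eq_integral do rewrite EFinM.
  rewrite ge0_integralZl_EFin//.
  - by rewrite -kmeanE.
  - by move=> y _; rewrite lee_fin; case/andP: (ug.2 y).
  - by apply/measurable_EFinP; case: ug.
  - by case/andP: (uphi.2 x).
apply: eq_integral => th _.
under eq_integral do rewrite mulrC EFinM.
rewrite ge0_integralZl_EFin//.
- by rewrite EFinM kmeanE.
- by move=> y _; rewrite lee_fin; case/andP: (uphi.2 y).
- by apply/measurable_EFinP; case: uphi.
- by case/andP: (ug.2 th).
Qed.

Lemma kmean_adjoint (phi : X -> R) (g : T -> R) : ufun phi -> ufun g ->
  \int[nu]_th (g th * kmean P phi th) = \int[M]_x (phi x * kmean Q g x).
Proof. by move=> up ug; rewrite /Rintegral ge0_kmean_adjoint. Qed.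

Lemma ge0_integral_kmeanQ (g : T -> R) : ufun g ->
  (\int[M]_x (kmean Q g x)%:E = \int[nu]_th (g th)%:E)%E.
Proof.
move=> ug; have := ge0_kmean_adjoint (@ufun_cst1 _ X R) ug.
under [in RHS]eq_integral do rewrite mul1r.
move=> <-; apply: eq_integral => th _.
by rewrite kmean_cst mulr1.
Qed.

Lemma ge0_integral_kmeanP (phi : X -> R) : ufun phi ->
  (\int[nu]_th (kmean P phi th)%:E = \int[M]_x (phi x)%:E)%E.
Proof.
move=> up; have := ge0_kmean_adjoint up (@ufun_cst1 _ T R).
under [in LHS]eq_integral do rewrite mul1r.
by move=> ->; apply: eq_integral => x _; rewrite kmean_cst mulr1.
Qed.

Lemma ufun1_kmeanQ g : ufun1 nu g -> ufun1 M (kmean Q g).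
Proof.
move=> [ug ig]; have uQ := ufun_kmean Q ug; split => //.
apply/integrableP; split; first by apply/measurable_EFinP; case: uQ.
under eq_integral.
  by move=> x _; rewrite gee0_abs ?lee_fin; [over|case/andP: (uQ.2 x)].
rewrite ge0_integral_kmeanQ//.
exact: (integrable_lty measurableT ig).
Qed.

Lemma ufun1_kmeanP g : ufun1 M g -> ufun1 nu (kmean P g).
Proof.
move=> [ug ig]; have uP := ufun_kmean P ug; split => //.
apply/integrableP; split; first by apply/measurable_EFinP; case: uP.
under eq_integral.
  by move=> x _; rewrite gee0_abs ?lee_fin; [over|case/andP: (uP.2 x)].
rewrite ge0_integral_kmeanP//.
exact: (integrable_lty measurableT ig).
Qed.

Lemma integral_kmeanQ (g : T -> R) : ufun g ->
  \int[M]_x kmean Q g x = \int[nu]_th g th.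
Proof. by move=> ug; rewrite /Rintegral ge0_integral_kmeanQ. Qed.

(* Nonnegativity of the Dirichlet form of [h - c g], expanded. *)
Lemma dirichlet_form_ge0 (h g : T -> R) (c : R) : ufun1 nu h -> ufun1 nu g ->
  2 * c * \int[nu]_th (h th * g th) + \int[M]_x (kmean Q h x ^+ 2)
    + c ^+ 2 * \int[M]_x (kmean Q g x ^+ 2) <=
  \int[nu]_th (h th ^+ 2) + c ^+ 2 * \int[nu]_th (g th ^+ 2)
    + 2 * c * \int[M]_x (kmean Q h x * kmean Q g x).
Proof.
move=> h1 g1.
have hg1 := ufun1M h1.1 g1; have hh1 := ufun1_sqr h1; have gg1 := ufun1_sqr g1.
have Qh := ufun1_kmeanQ h1; have Qg := ufun1_kmeanQ g1.
rewrite -(integral_kmeanQ hg1.1) -(integral_kmeanQ hh1.1) -(integral_kmeanQ gg1.1).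
have [_ i1] := ufun1_kmeanQ hg1; have [_ i2] := ufun1_kmeanQ hh1.
have [_ i3] := ufun1_kmeanQ gg1.
have [_ i4] := ufun1_sqr Qh; have [_ i5] := ufun1_sqr Qg.
have [_ i6] := ufun1M Qh.1 Qg.
have intZ r f : M.-integrable setT (EFin \o f) ->
    M.-integrable setT (EFin \o (fun x => r * f x)).
  by move=> fi; exact: (integrableZl measurableT _ fi).
have intD f1 f2 : M.-integrable setT (EFin \o f1) ->
    M.-integrable setT (EFin \o f2) ->
    M.-integrable setT (EFin \o (fun x => f1 x + f2 x)).
  by move=> f1i f2i; exact: (integrableD measurableT f1i f2i).
have il := intD _ _ (intZ (2 * c) _ i1) i4.
have ir := intD _ _ i2 (intZ (c ^+ 2) _ i3).
have ill := intD _ _ il (intZ (c ^+ 2) _ i5).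
have irr := intD _ _ ir (intZ (2 * c) _ i6).
(* With the [nu]-integrals rewritten as [M]-integrals of means under [Q], the form is the
   [M]-integral of the variance of h - c g under [Q x], so [mean_form] applies at each x. *)
have : \int[M]_x (2 * c * kmean Q (fun th => h th * g th) x + kmean Q h x ^+ 2
    + c ^+ 2 * kmean Q g x ^+ 2) <=
  \int[M]_x (kmean Q (fun th => h th ^+ 2) x + c ^+ 2 * kmean Q (fun th => g th ^+ 2) x
    + 2 * c * (kmean Q h x * kmean Q g x)).
  apply: le_Rintegral => // x _; apply: mean_form; [exact: prob_kernel|exact: h1.1|exact: g1.1].
by rewrite !(RintegralD, RintegralZl)//; exact: intZ.
Qed.

End reversible.

(** * Hitting probabilities of a reversible chain *)

Section hitting.
Context dT dX (T : measurableType dT) (X : measurableType dX) (R : realType).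
Variables (P : R.-pker T ~> X) (Q : R.-pker X ~> T).

Definition kstep (f : T -> R) : T -> R := kmean P (kmean Q f).

(* [nohit C n x] is the probability that the chain started at [x] avoids [C] at
   times 1, ..., n, and [hit C n x] the probability that it meets [C] at one of
   the times 0, ..., n. *)
Fixpoint nohit (C : set T) n : T -> R :=
  if n is m.+1 then kstep (fun y => \1_(~` C) y * nohit C m y) else fun=> 1.

Definition hit C n x : R := 1 - \1_(~` C) x * nohit C n x.

Lemma ufun_kstep f : ufun f -> ufun (kstep f).
Proof. by move=> uf; exact/ufun_kmean/ufun_kmean. Qed.

Lemma kstep_le f g x : ufun f -> ufun g -> (forall y, f y <= g y) ->
  kstep f x <= kstep g x.
Proof.
move=> uf ug fg; apply: kmean_le; [exact: ufun_kmean..|].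
by move=> y; exact: kmean_le.
Qed.

Lemma kstep_onem f x : ufun f -> kstep (fun y => 1 - f y) x = 1 - kstep f x.
Proof.
move=> uf; rewrite -kmean_onem; last exact: ufun_kmean.
by congr kmean; apply/funext => y; exact: kmean_onem.
Qed.

Variable C : set T.
Hypothesis mC : measurable C.

Lemma ufun_nohit n : ufun (nohit C n).
Proof.
elim: n => [|n ih]; first exact: ufun_cst1.
apply: ufun_kstep; apply: ufunM => //; apply: ufun_indic; exact: measurableC.
Qed.

Lemma ufun_miss n : ufun (fun y => \1_(~` C) y * nohit C n y).
Proof. by apply: ufunM (ufun_nohit n); apply: ufun_indic; exact: measurableC. Qed.

Lemma ufun_hit n : ufun (hit C n).
Proof. exact: ufun_onem (ufun_miss n). Qed.

Lemma nohit_le n x : nohit C n.+1 x <= nohit C n x.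
Proof.
elim: n x => [|n ih] x; first by have /andP[_] := (ufun_nohit 1).2 x.
apply: (kstep_le x (ufun_miss n.+1) (ufun_miss n)).
by move=> y; apply: ler_wpM2l => //; rewrite indicE.
Qed.

Lemma hit_in n x : C x -> hit C n x = 1.
Proof. by move=> Cx; rewrite /hit indicE memNset ?mul0r ?subr0//; exact. Qed.

Lemma hit_le n x : hit C n x <= hit C n.+1 x.
Proof. by rewrite /hit lerD2l lerN2 ler_wpM2l// ?nohit_le// indicE. Qed.

(** Everywhere [kstep (hit C n)] equals 1 - v_(n+1). Off C this already is h_(n+1); on C, where
    h_(n+1) = 1, the missing v_(n+1) has to be added back. *)
Lemma hitS n x : hit C n.+1 x = kstep (hit C n) x + \1_C x * nohit C n.+1 x.
Proof.
rewrite [kstep _ x]kstep_onem; last exact: ufun_miss.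
rewrite -[kstep _ x]/(nohit C n.+1 x) /hit.
rewrite !indicE in_setC; case: (x \in C) => /=; lra.
Qed.

(** * Energy of the hitting probabilities *)

Section energy.
Variables (nu : {measure set T -> \bar R}) (M : {measure set X -> \bar R}).
Hypothesis PQ : forall f : X * T -> \bar R, measurable_fun setT f ->
  (forall z, 0 <= f z)%E ->
  (\int[nu]_th \int[P th]_x f (x, th) = \int[M]_x \int[Q x]_th f (x, th))%E.
Hypothesis nuC : (nu C < +oo)%E.

Lemma ufun1_escape n : ufun1 nu (fun x => \1_C x * nohit C n x).
Proof.
rewrite (_ : (fun x => _) = fun x => nohit C n x * \1_C x); last first.
  by apply/funext => x; rewrite mulrC.
by apply: ufun1M; [exact: ufun_nohit|exact: ufun1_indic].
Qed.

Lemma ufun1_kstep f : ufun1 nu f -> ufun1 nu (kstep f).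
Proof. by move=> f1; apply: (ufun1_kmeanP PQ); exact: (ufun1_kmeanQ PQ). Qed.

(** Integrability propagates along [hitS]: [kstep] preserves it, since [nu] is invariant, and the
    added term is dominated by the indicator of C. *)
Lemma ufun1_hit n : ufun1 nu (hit C n).
Proof.
elim: n => [|n ih].
  rewrite (_ : hit C 0 = \1_C); first exact: ufun1_indic.
  by apply/funext => x; rewrite /hit/= mulr1 !indicE in_setC; case: (_ \in _); rewrite /= ?subrr ?subr0.
have uh := ufun_hit n.+1; move: uh; rewrite (_ : hit C n.+1 =
  fun x => kstep (hit C n) x + \1_C x * nohit C n.+1 x); last first.
  by apply/funext => x; exact: hitS.
by apply: ufun1D; [exact: ufun1_kstep|exact: ufun1_escape].
Qed.

(** As [P] is the adjoint of [Q], the transition operator is Q*Q; its quadratic form is the squared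
    norm of [Q f] in L2(M). *)
Lemma integral_kstepM f g : ufun f -> ufun g ->
  \int[nu]_x (f x * kstep g x) = \int[M]_x (kmean Q f x * kmean Q g x).
Proof.
move=> uf ug; rewrite (kmean_adjoint PQ)//; last exact: ufun_kmean.
by apply: eq_Rintegral => x _; rewrite mulrC.
Qed.

Lemma integral_hitSM n g : ufun1 nu g ->
  \int[nu]_x (hit C n.+1 x * g x) = \int[M]_x (kmean Q (hit C n) x * kmean Q g x)
    + \int[nu]_x (\1_C x * nohit C n.+1 x * g x).
Proof.
move=> g1.
have -> : \int[M]_x (kmean Q (hit C n) x * kmean Q g x) =
    \int[nu]_x (g x * kstep (hit C n) x).
  rewrite integral_kstepM; [|exact: g1.1|exact: ufun_hit].
  by apply: eq_Rintegral => x _; rewrite mulrC.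
rewrite -RintegralD//.
- by apply: eq_Rintegral => x _; rewrite hitS; ring.
- have [_] := ufun1M g1.1 (ufun1_kstep (ufun1_hit n)); exact.
- have [_] := ufun1M (ufunM (ufun_indic mC) (ufun_nohit n.+1)) g1; exact.
Qed.

(** Since h_n <= h_(n+1), the squared norm of h_n is at most the inner product of h_(n+1) and h_n.
    By [integral_hitSM] the latter is the squared norm of Q h_n plus an escape term, in which the
    factor h_n <= 1 is dropped. *)
Lemma hit_energy n :
  \int[nu]_x (hit C n x ^+ 2) <= \int[M]_x (kmean Q (hit C n) x ^+ 2)
    + \int[nu]_x (\1_C x * nohit C n.+1 x).
Proof.
have uh := ufun_hit n; have h1 := ufun1_hit n.
have e := integral_hitSM n h1.
apply: (@le_trans _ _ (\int[nu]_x (hit C n.+1 x * hit C n x))).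
  apply: le_Rintegral => //.
  - by case: (ufun1_sqr h1).
  - by case: (ufun1M (ufun_hit n.+1) h1).
  - move=> x _; rewrite expr2 ler_wpM2r ?hit_le//; by case/andP: (uh.2 x).
rewrite e lerD2l; apply: le_Rintegral => //.
- by case: (ufun1M (ufunM (ufun_indic mC) (ufun_nohit n.+1)) h1).
- by case: (ufun1_escape n.+1).
- move=> x _; rewrite ler_piMr//; last by case/andP: (uh.2 x).
  by case/andP: ((ufun1_escape n.+1).1.2 x).
Qed.

(** In the expanded form of h_n - c g, the energy of h_n is at most nu(C) by [hit_energy], that of g
    at most [delta], and [integral_hitSM] turns the cross term into the integral of h_(n+1) g minus
    the escape integral. *)
Lemma escape_le (g : T -> R) (c delta : R) n : 0 <= c -> ufun1 nu g ->
  \int[nu]_x (g x ^+ 2) <= \int[M]_x (kmean Q g x ^+ 2) + delta ->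
  2 * c * \int[nu]_x (\1_C x * nohit C n.+1 x * g x) <=
    fine (nu C) + c ^+ 2 * delta
    + 2 * c * (\int[nu]_x (hit C n.+1 x * g x) - \int[nu]_x (hit C n x * g x)).
Proof.
move=> c0 g1 gd; have h1 := ufun1_hit n.
have := dirichlet_form_ge0 PQ c h1 g1.
have := hit_energy n.
have : \int[nu]_x (\1_C x * nohit C n.+1 x) <= fine (nu C).
  apply: (@le_trans _ _ (\int[nu]_x \1_C x)); last first.
    by rewrite /Rintegral integral_indic// setIT.
  apply: le_Rintegral => //.
  - by case: (ufun1_escape n.+1).
  - by case: (ufun1_indic mC nuC).
  - move=> x _; rewrite ler_piMr ?indicE//.
    by case/andP: ((ufun_nohit n.+1).2 x).
rewrite (integral_hitSM n g1).
have := ler_wpM2l (sqr_ge0 c) gd.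
lra.
Qed.

End energy.
End hitting.

(** If every increment exceeded e, the sequence would grow at least linearly and pass b. *)
Lemma small_increment (R : realType) (u : R ^nat) (b e : R) :
  (forall n, u n <= b) -> 0 < e -> exists n, u n.+1 - u n <= e.
Proof.
move=> ub e0; apply: contrapT => /forallNP no.
have lin n : u 0%N + n%:R * e <= u n.
  elim: n => [|n ih]; first by rewrite mul0r addr0.
  by have /negP := no n; rewrite -ltNge -natr1; lra.
pose m := (Num.truncn (`|b - u 0%N| / e)).+1.
have : `|b - u 0%N| / e < m%:R by exact: truncnS_gt.
rewrite ltr_pdivrMr// => mb.
have := lin m; have := ub m; have := ler_norm (b - u 0%N); lra.
Qed.

(** * Escape from sets of zero capacity *)

Section null_escape.
Context dT dX (T : measurableType dT) (X : measurableType dX) (R : realType).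
Variables (P : R.-pker T ~> X) (Q : R.-pker X ~> T).
Variables (nu : {measure set T -> \bar R}) (M : {measure set X -> \bar R}).
Hypothesis PQ : forall f : X * T -> \bar R, measurable_fun setT f ->
  (forall z, 0 <= f z)%E ->
  (\int[nu]_th \int[P th]_x f (x, th) = \int[M]_x \int[Q x]_th f (x, th))%E.
Variables C D : set T.
Hypotheses (mC : measurable C) (nuC : (nu C < +oo)%E) (mD : measurable D).
Hypothesis D_capacity0 : forall delta, 0 < delta -> exists g,
  [/\ ufun1 nu g, (forall x, D x -> g x = 1) &
      \int[nu]_x (g x ^+ 2) <= \int[M]_x (kmean Q g x ^+ 2) + delta].

(** [nohit] decreases in n, so the bound for all n is a bound on the probability of never returning,
    expressed without a limit. *)
Let escaping eps := C `&` D `&` [set x | forall n, eps <= nohit P Q C n x].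

Lemma measurable_escaping eps : measurable (escaping eps).
Proof.
apply: measurableI; first exact: measurableI.
rewrite (_ : [set x | _] = \bigcap_n [set x | eps <= nohit P Q C n x]).
  apply: bigcap_measurable => // n _.
  rewrite -[X in measurable X]setTI.
  by apply: measurable_fun_le => //; case: (ufun_nohit P Q mC n).
by apply/seteqP; split => [x h n _|x h n]; [exact: h|exact: h].
Qed.

(** If the set had mass b > 0, the escape integral against any g equal to 1 on D would be at least
    eps b for every n. The inequality [escape_le] forbids this once c is large, the energy of g
    small and n well chosen. *)
Lemma escaping_null eps : 0 < eps -> nu (escaping eps) = 0%E.
Proof.
move=> eps0; set B := escaping eps.
have mB : measurable B by exact: measurable_escaping.
have Boo : (nu B < +oo)%E.
  by apply: le_lt_trans nuC; apply: le_measure; rewrite ?inE// => x [[]].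
have numB : nu B \is a fin_num by rewrite ge0_fin_numE.
suff : fine (nu B) <= 0.
  move=> B0; apply/eqP; rewrite -fine_eq0//; apply/eqP/le_anti.
  by rewrite B0 fine_ge0.
rewrite leNgt; apply/negP => B0.
set b := fine (nu B) in B0; set a := fine (nu C).
have a0 : 0 <= a by exact: fine_ge0.
have eta0 : 0 < eps * b by exact: mulr_gt0.
set eta := eps * b in eta0.
(* Here c eta = 2 (a + 1). With energy tolerance eta / (2 c) and increment at most eta / 4,
   [escape_le] reads 2 c eta <= a + c eta / 2 + c eta / 2, that is c eta <= a, a contradiction. *)
pose c := 2 * (a + 1) / eta.
have c0 : 0 < c by rewrite divr_gt0// mulr_gt0//; lra.
have d0 : 0 < eta / (2 * c) by rewrite divr_gt0// mulr_gt0.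
have [g [g1 gD gd]] := D_capacity0 d0.
have r0 : 0 < eta / 4 by lra.
(* The integrals of h_n g are bounded by that of g because h_n <= 1. *)
have [n rn] := @small_increment R (fun n => \int[nu]_x (hit P Q C n x * g x))
  (\int[nu]_x g x) (eta / 4) (fun n => ltac:(
    apply: le_Rintegral => //; [by case: (ufun1M (ufun_hit P Q mC n) g1)|by case: g1|
    by move=> x _; rewrite ler_piMl//; [case/andP: (g1.1.2 x)|case/andP: ((ufun_hit P Q mC n).2 x)]])) r0.
have := escape_le mC PQ nuC n (ltW c0) g1 gd.
rewrite -/a.
have low : eta <= \int[nu]_x (\1_C x * nohit P Q C n.+1 x * g x).
  have -> : eta = \int[nu]_x (eps * \1_B x).
    rewrite RintegralZl//; last by case: (ufun1_indic mB Boo).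
    by rewrite /Rintegral integral_indic// setIT.
  apply: le_Rintegral => //.
  - apply: (integrableZl measurableT eps (f := EFin \o \1_B)).
    by case: (ufun1_indic mB Boo).
  - by case: (ufun1M (ufunM (ufun_indic mC) (ufun_nohit P Q mC n.+1)) g1).
  - move=> x _; rewrite [\1_B x]indicE; case: (boolP (x \in B)) => [|_].
      rewrite inE => -[[Cx Dx] Ex].
      by rewrite (_ : \1_C x = 1) ?indicE ?mem_set// mul1r gD// !mulr1; exact: Ex.
    rewrite mulr0; apply: mulr_ge0; last by case/andP: (g1.1.2 x).
    by case/andP: ((ufunM (ufun_indic mC) (ufun_nohit P Q mC n.+1)).2 x).
have cE : c * eta = 2 * (a + 1) by rewrite /c divfK// gt_eqF.
have dE : c ^+ 2 * (eta / (2 * c)) = c * eta / 2 by field; rewrite gt_eqF.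
rewrite dE cE => up.
have : 2 * c * eta <= 2 * c * \int[nu]_x (\1_C x * nohit P Q C n.+1 x * g x).
  by rewrite ler_wpM2l// mulr_ge0// ltW.
have : 2 * c * (\int[nu]_x (hit P Q C n.+1 x * g x) - \int[nu]_x (hit P Q C n x * g x))
  <= 2 * c * (eta / 4).
  by rewrite ler_wpM2l// mulr_ge0// ltW.
move: cE; set p := c * eta => cE.
rewrite (_ : 2 * c * (eta / 4) = p / 2); last by rewrite /p; field.
rewrite (_ : 2 * c * eta = 2 * p); last by rewrite /p; ring.
lra.
Qed.

End null_escape.

(** * Realizations of the chain *)

Section realization.
Context dT dX (T : measurableType dT) (X : measurableType dX) (R : realType).
Variables (P : R.-pker T ~> X) (Q : R.-pker X ~> T).
Local Notation K := (fun eta C => \int[P eta]_x Q x C)%E.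
Context dO (Om : measurableType dO) (Pr : probability Om R) (w0 : T) (W : nat -> Om -> T).
Hypothesis WK : mc_realization Pr K w0 W.

Let cylinder (A : nat -> set T) n := \bigcap_(k in [set k | (k <= n)%N]) (W k @^-1` A k).

Let mW n (B : set T) : measurable B -> measurable (W n @^-1` B).
Proof. by case: WK => + _ _ => /(_ n) h mB; rewrite -[X in measurable X]setTI; exact: h. Qed.

Let measurable_cylinder A n : (forall k, measurable (A k)) -> measurable (cylinder A n).
Proof. by move=> mA; apply: bigcap_measurable => [|k _]; [exists 0%N|exact: mW]. Qed.

Lemma integral_kcomp_noparam (f : T -> R) eta : ufun f ->
  (\int[mkcomp_noparam P Q eta]_y (f y)%:E = (kstep P Q f eta)%:E)%E.
Proof.
move=> uf.
rewrite (@ge0_integral_mixture _ T R _ X (P eta) Q)//.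
- rewrite kmeanE; last exact: ufun_kmean.
  by apply: eq_integral => x _; rewrite kmeanE.
- exact: measurable_kernel.
- by apply/measurable_EFinP; case: uf.
- by move=> z; rewrite lee_fin; case/andP: (uf.2 z).
Qed.

(** The Markov property is given on sets only. It says that on a cylinder the mixtures of the Dirac
    masses at W_(n+1) and of the transition laws from W_n agree on sets, hence on functions. *)
Lemma realization_integral A n (f : T -> R) : (forall k, measurable (A k)) ->
  ufun f ->
  (\int[Pr]_(om in cylinder A n) (f (W n.+1 om))%:E =
   \int[Pr]_(om in cylinder A n) (kstep P Q f (W n om))%:E)%E.
Proof.
move=> mA uf; have [mfW _ markov] := WK.
have mE := measurable_cylinder n mA; set E := cylinder A n in mE *.
have mf : measurable_fun setT (EFin \o f) by apply/measurable_EFinP; case: uf.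
have f0 z : (0 <= (EFin \o f) z)%E by rewrite lee_fin; case/andP: (uf.2 z).
transitivity (\int[Pr]_(om in E) \int[\d_(W n.+1 om)]_z (f z)%:E)%E.
  by apply: eq_integral => om _; rewrite integral_dirac// diracT mul1e.
transitivity (\int[Pr]_(om in E) \int[mkcomp_noparam P Q (W n om)]_z (f z)%:E)%E; last first.
  by apply: eq_integral => om _; exact: integral_kcomp_noparam.
apply: eq_integral_mixture => //.
- by move=> U mU; apply: (measurableT_comp (measurable_fun_dirac mU)); exact: mfW.
- move=> U mU; apply: (measurableT_comp (f := fun x => mkcomp_noparam P Q x U)); last exact: mfW.
  exact: measurable_kernel.
- move=> B mB; rewrite -[RHS]markov//.
  rewrite setIC -integral_indic//; last exact: mW.
Qed.

Variable C : set T.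
Hypothesis mC : measurable C.

(** Time 0 is left unconstrained because visits are counted from time 1 on. *)
Let avoid n := cylinder (fun k => if k == 0%N then setT else ~` C) n.

Let mavoid k : measurable (if k == 0%N then setT else ~` C).
Proof. by case: ifP => // _; exact: measurableC. Qed.

Let avoidS n : avoid n.+1 = avoid n `&` W n.+1 @^-1` (~` C).
Proof.
apply/seteqP; split => om.
  move=> h; split; first by move=> k /= kn; apply: h; exact: leqW.
  by have := h n.+1 (leqnn _).
move=> [h hn] k /=; rewrite leq_eqVlt ltnS => /predU1P[->//|]; exact: h.
Qed.

Let avoid_step n j :
  (\int[Pr]_(om in avoid n) (nohit P Q C j.+1 (W n om))%:E =
   \int[Pr]_(om in avoid n.+1) (nohit P Q C j (W n.+1 om))%:E)%E.
Proof.
rewrite -realization_integral//; last exact: ufun_miss.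
rewrite avoidS integral_mkcondr; apply: eq_integral => om _.
rewrite patchE indicE; case: ifPn => h; first by rewrite (_ : _ \in _ = true) ?mul1r//; exact: h.
by rewrite (_ : _ \in _ = false) ?mul0r//; exact/negbTE.
Qed.

(** Each use of the Markov property moves one future step from [nohit] into the event, keeping n + j
    fixed. At n = 0 this identifies [nohit C j w0] with the probability of [avoid j]. *)
Let avoid_nohit n j :
  (\int[Pr]_(om in avoid n) (nohit P Q C j (W n om))%:E = Pr (avoid (n + j)))%E.
Proof.
elim: j n => [|j ih] n; last by rewrite avoid_step ih addSnnS.
rewrite /= addn0 integral_cst ?mul1e//.
exact: measurable_cylinder.
Qed.

Let nohitE n : (nohit P Q C n w0)%:E = Pr (avoid n).
Proof.
rewrite -[RHS](avoid_nohit 0 n); case: WK => _ W0 _.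
have -> : avoid 0 = setT.
  by apply/seteqP; split => // om _ k; rewrite /= leqn0 => /eqP ->.
under eq_integral do rewrite W0.
rewrite integral_cst// -[LHS]mule1; congr (_ * _)%E; apply/esym.
exact: (probability_setT Pr).
Qed.

Let avoid_all : \bigcap_n avoid n = ~` hit_event W C.
Proof.
apply/seteqP; split => om /=.
  by move=> h [n Cn]; have /= := h n.+1 Logic.I n.+1 (leqnn _).
move=> h n _ [|k] //= kn Ck; apply: h; by exists k.
Qed.

Let mavoidn n : measurable (avoid n). Proof. exact: measurable_cylinder. Qed.

Let mhit : measurable (hit_event W C).
Proof.
rewrite -[hit_event W C]setCK -avoid_all; apply: measurableC.
by apply: bigcap_measurable => //; exists 0%N.
Qed.

(** The witness is the probability of never meeting C, an event contained in every [avoid n]. *)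
Lemma nohit_lower_bound : (Pr (hit_event W C) < 1)%E ->
  exists2 eps, 0 < eps & forall n, eps <= nohit P Q C n w0.
Proof.
move=> lt1; have e := probability_setC Pr mhit.
have fin A : measurable A -> Pr A \is a fin_num by exact: fin_num_measure.
have mavoid_all := measurableC mhit.
exists (fine (Pr (~` hit_event W C))).
  rewrite -lte_fin fineK; last exact: fin.
  by rewrite e sube_gt0.
move=> n; rewrite -lee_fin nohitE fineK; last exact: fin.
apply: le_measure; rewrite ?inE; [exact: mavoid_all|exact: mavoidn|rewrite -avoid_all; exact: bigcap_inf].
Qed.

(** Continuity from above along the decreasing events [avoid n], whose intersection is the
    complement of the hitting event. *)
Lemma nohit_cvg0 : (1 <= Pr (hit_event W C))%E ->
  (nohit P Q C n w0)%:E @[n --> \oo] --> 0%E.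
Proof.
move=> le1; have e := probability_setC Pr mhit.
have h1 : Pr (hit_event W C) = 1%E by apply/le_anti; rewrite le1 probability_le1.
have -> : 0%E = Pr (\bigcap_n avoid n) by rewrite avoid_all e h1 subee.
under eq_fun do rewrite nohitE.
apply: nonincreasing_cvg_mu => //.
- by rewrite (le_lt_trans (probability_le1 _ _)) ?ltry//; exact: mavoidn.
- by apply: bigcap_measurable => //; exists 0%N.
- apply/nonincreasing_seqP => n; apply/subsetPset; rewrite avoidS; exact: subIsetl.
Qed.

End realization.

(** * Existence of a realization *)

Lemma integral_probability_cst d (O : measurableType d) (R : realType)
  (U : probability O R) (r : \bar R) : (\int[U]__ r)%E = r.
Proof.
rewrite integral_cst// -[RHS]mule1; congr (_ * _)%E; exact: (probability_setT U).
Qed.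

(* A probability space carrying two independent copies of itself feeds any
   number of transitions: [X v] drives one step and [Y v] is kept for the later ones. *)
Section chain_of_split.
Local Open Scope ereal_scope.
Context dO dS (O : measurableType dO) (S : measurableType dS) (R : realType).
Variables (U : probability O R) (X Y : O -> O) (q : S * O -> S)
  (K : S -> set S -> \bar R).
Hypotheses (mX : measurable_fun setT X) (mY : measurable_fun setT Y)
  (mq : measurable_fun setT q).
Hypothesis XY : forall f : O * O -> \bar R, measurable_fun setT f ->
  (forall z, 0 <= f z) ->
  \int[U]_v f (X v, Y v) = \int[U]_x \int[U]_y f (x, y).
Hypothesis qK : forall w B, measurable B -> U [set x | B (q (w, x))] = K w B.
Variable w0 : S.

Fixpoint split_chain n (om : O) : S * O :=
  if n is m.+1 then
    let: (w, v) := split_chain m om in (q (w, X v), Y v)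
  else (w0, om).

Let W n om := (split_chain n om).1.
Let V n om := (split_chain n om).2.

Let WS n om : W n.+1 om = q (W n om, X (V n om)).
Proof. by rewrite /W /V /=; case: (split_chain n om). Qed.

Let VS n om : V n.+1 om = Y (V n om).
Proof. by rewrite /V /=; case: (split_chain n om). Qed.

Let mWV n : measurable_fun setT (W n) /\ measurable_fun setT (V n).
Proof.
elim: n => [|n [mW mV]]; first by split; [exact: measurable_cst|exact: measurable_id].
split.
  rewrite (_ : W n.+1 = fun om => q (W n om, X (V n om))); last first.
    by apply/funext => om; exact: WS.
  apply: (measurableT_comp mq); apply: measurable_fun_pair => //.
  exact: (measurableT_comp mX).
rewrite (_ : V n.+1 = Y \o V n); first exact: measurableT_comp.
by apply/funext => om; exact: VS.
Qed.

Let cylinder (A : nat -> set S) n := \bigcap_(k in [set k | (k <= n)%N]) (W k @^-1` A k).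

Let cylinderS A n : cylinder A n.+1 = cylinder A n `&` W n.+1 @^-1` A n.+1.
Proof.
apply/seteqP; split => om.
  move=> h; split; first by move=> k /= kn; apply: h; exact: leqW.
  by have := h n.+1 (leqnn _).
move=> [h hn] k /=; rewrite leq_eqVlt ltnS => /predU1P[->//|]; exact: h.
Qed.

Let measurable_marginal (F : S * O -> \bar R) : measurable_fun setT F ->
  (forall z, 0 <= F z) -> measurable_fun setT (fun w => \int[U]_v F (w, v)).
Proof.
by move=> mF F0; exact: measurable_fun_fubini_tonelli_F.
Qed.

Let fresh (A : nat -> set S) n (F : S * O -> \bar R) :
  (forall k, measurable (A k)) -> measurable_fun setT F -> (forall z, 0 <= F z) ->
  \int[U]_(om in cylinder A n) F (W n om, V n om) =
  \int[U]_(om in cylinder A n) \int[U]_v F (W n om, v).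
Proof.
move=> mA; elim: n F => [|n ih] F mF F0.
  have [A0|A0] := pselect (A 0%N w0).
    have -> : cylinder A 0 = setT.
      by apply/seteqP; split => // om _ k; rewrite /= leqn0 => /eqP ->.
    by rewrite /W /V /= integral_probability_cst.
  have -> : cylinder A 0 = set0.
    by apply/seteqP; split => // om /(_ 0%N (leqnn _)).
  by rewrite !integral_set0.
(* The constraint at time n + 1 becomes a factor of the integrand, leaving the cylinder at time n to
   the induction hypothesis. *)
pose ind w := (\1_(A n.+1) w)%:E : \bar R.
have ind0 w : 0 <= ind w by rewrite lee_fin.
have mind : measurable_fun setT ind by apply/measurable_EFinP; exact: measurable_indic.
(* Both sides of the goal are computed by this formula, with G equal to F and to its average over
   the second variable; the inner integral of the average is that of a constant. *)
have step (G : S * O -> \bar R) : measurable_fun setT G -> (forall z, 0 <= G z) ->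
    \int[U]_(om in cylinder A n.+1) G (W n.+1 om, V n.+1 om) =
    \int[U]_(om in cylinder A n) \int[U]_x (ind (q (W n om, x)) *
       \int[U]_y G (q (W n om, x), y)).
  move=> mG G0.
  rewrite cylinderS integral_mkcondr.
  under eq_integral => om _.
    rewrite (_ : _ \_ _ = fun om => ind (q (W n om, X (V n om))) *
       G (q (W n om, X (V n om)), Y (V n om))); last first.
      apply/funext => om'; rewrite patchE -WS -VS /ind indicE.
      case: ifPn => h; first by rewrite (_ : _ \in _ = true) ?mul1e//; exact: h.
      by rewrite (_ : _ \in _ = false) ?mul0e//; exact/negbTE.
    over.
  have mqx : measurable_fun setT (fun z : S * O => q (z.1, X z.2)).
    apply: (measurableT_comp mq); apply: measurable_fun_pair => //.
    by apply: (measurableT_comp mX); exact: measurable_snd.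
  rewrite (ih (fun z => ind (q (z.1, X z.2)) * G (q (z.1, X z.2), Y z.2))) /=.
  - apply: eq_integral => om _.
    have mqw : measurable_fun setT (fun x => q (W n om, x)).
      by apply: (measurableT_comp mq); exact: pair1_measurable.
    rewrite (XY (f := fun z => ind (q (W n om, z.1)) * G (q (W n om, z.1), z.2))) /=.
    + apply: eq_integral => x _; rewrite ge0_integralZl//.
      by apply: (measurableT_comp mG); exact: pair1_measurable.
    + apply: emeasurable_funM.
        by apply: (measurableT_comp mind); apply: (measurableT_comp mqw); exact: measurable_fst.
      apply: (measurableT_comp mG); apply: measurable_fun_pair; last exact: measurable_snd.
      by apply: (measurableT_comp mqw); exact: measurable_fst.
    + by move=> z; exact: mule_ge0.
  - apply: emeasurable_funM; first exact: (measurableT_comp mind).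
    apply: (measurableT_comp mG); apply: measurable_fun_pair => //.
    by apply: (measurableT_comp mY); exact: measurable_snd.
  - by move=> z; exact: mule_ge0.
rewrite step// (step (fun z => \int[U]_v F (z.1, v))).
- apply: eq_integral => om _; apply: eq_integral => x _ /=.
  by congr (_ * _); rewrite integral_probability_cst.
- exact: (measurableT_comp (measurable_marginal mF F0) (@measurable_fst _ _ S O)).
- by move=> z; exact: integral_ge0.
Qed.

(** W_(n+1) is [q] of W_n and X(V_n), where V_n is independent of the past by [fresh]; [XY] gives
    X(V_n) the law [U], and [qK] recognizes the transition. *)
Lemma split_chain_realization : mc_realization U K w0 W.
Proof.
split => [n|//|n A B mA mB]; first by case: (mWV n).
have mcyl k (D : set S) : measurable D -> measurable (W k @^-1` D).
  by move=> mD; rewrite -[X in measurable X]setTI; exact: (mWV k).1.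
have mC : measurable (cylinder A n).
  by apply: bigcap_measurable => [|k _]; [exists 0%N|exact: mcyl].
have mqB w : measurable [set x | B (q (w, x))].
  rewrite -[X in measurable X]setTI.
  by apply: (measurableT_comp mq (pair1_measurable w)).
rewrite setIC -integral_indic//; last exact: mcyl.
have mind : measurable_fun setT (fun w => (\1_B w)%:E : \bar R).
  by apply/measurable_EFinP; exact: measurable_indic.
under eq_integral do rewrite [\1_ _ _]/(\1_B (W n.+1 _)) WS.
rewrite -/(cylinder A n) (fresh n (F := fun z => (\1_B (q (z.1, X z.2)))%:E)) //=.
- apply: eq_integral => om _.
  have mf : measurable_fun setT (fun x => (\1_B (q (W n om, x)))%:E : \bar R).
    by apply: (measurableT_comp mind); apply: (measurableT_comp mq); exact: pair1_measurable.
  rewrite (XY (f := fun z => (\1_B (q (W n om, z.1)))%:E)) /=.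
  + under eq_integral do rewrite integral_probability_cst.
    rewrite -qK// -[in RHS](setIT [set x | _]) -integral_indic//.
  + by apply: (measurableT_comp mf); exact: measurable_fst.
  + by move=> z; rewrite lee_fin.
- apply: (measurableT_comp mind); apply: (measurableT_comp mq).
  apply: measurable_fun_pair; first exact: measurable_fst.
  by apply: (measurableT_comp mX); exact: measurable_snd.
Qed.

End chain_of_split.

(** This and the next three lemmas hide constructions of measures behind existentials, so that only
    the values on sets are visible afterwards. *)
Lemma image_measure d d' (S : measurableType d) (S' : measurableType d')
    (R : realType) (m : {measure set S -> \bar R}) (f : S -> S') :
  measurable_fun setT f ->
  exists m' : {measure set S' -> \bar R}, forall A, m' A = m (f @^-1` A).
Proof.
move=> mf; pose m' : {measure set S' -> \bar R} := [the measure _ _ of pushforward m f].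
by exists (m' mf).
Qed.

Lemma restricted_measure d (S : measurableType d) (R : realType)
    (m : {measure set S -> \bar R}) (D : set S) : measurable D ->
  exists m' : {measure set S -> \bar R}, forall A, m' A = m (A `&` D).
Proof. by move=> mD; exists (mrestr m mD). Qed.

Lemma scaled_measure d (S : measurableType d) (R : realType)
    (m : {measure set S -> \bar R}) (r : R) : 0 <= r ->
  exists m' : {measure set S -> \bar R}, forall A, m' A = (r%:E * m A)%E.
Proof. by move=> r0; exists (mscale (NngNum r0) m). Qed.

Lemma sum_measure d (S : measurableType d) (R : realType)
    (m1 m2 : {measure set S -> \bar R}) :
  exists m' : {measure set S -> \bar R}, forall A, m' A = (m1 A + m2 A)%E.
Proof. by exists (measure_add m1 m2) => A; exact: measure_addE. Qed.

(** Iterating gives |d i| <= b / 2^n for every n. It serves as a uniqueness principle for bounded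
    solutions of dyadic functional equations. *)
Lemma halving_eq0 (R : realType) (I : Type) (d : I -> R) (b : R) :
  (forall i, `|d i| <= b) -> (forall i, exists j, `|d i| <= 2^-1 * `|d j|) ->
  forall i, d i = 0.
Proof.
move=> db half i; apply/eqP/negP => /negP di0.
have iter n : forall i, `|d i| <= b / 2 ^+ n.
  elim: n => [|n ih] k; first by rewrite expr0 divr1.
  have [j dj] := half k; apply: (le_trans dj).
  have := ih j; rewrite exprS invfM; set p := (2 ^+ n)^-1; lra.
have di : 0 < `|d i| by rewrite normr_gt0.
have b0 : 0 < b by exact: lt_le_trans (db i).
pose n := (Num.truncn (b / `|d i|)).+1.
have : b / `|d i| < n%:R by exact: truncnS_gt.
rewrite ltr_pdivrMr// => bn.
have := iter n i; rewrite ler_pdivlMr ?exprn_gt0// => h.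
have : n%:R <= 2 ^+ n :> R by rewrite -natrX ler_nat ltnW// ltn_expl.
move=> n2; have : n%:R * `|d i| <= `|d i| * 2 ^+ n by rewrite mulrC ler_wpM2l.
lra.
Qed.

(** * Finite measures on the line are determined by left rays *)

Section ray_uniqueness.
Context (R : realType).

(** Finite total mass allows passing to complements, and the open right rays are a generating family
    closed under intersection. *)
Lemma measure_ray_unique (m1 m2 : {measure set R -> \bar R}) :
  (m1 setT < +oo)%E -> m1 setT = m2 setT ->
  (forall x, m1 `]-oo, x]%classic = m2 `]-oo, x]%classic) ->
  forall A, measurable A -> m1 A = m2 A.
Proof.
move=> fin e rays A mA.
pose g n : set R := `](- n%:R), +oo[%classic.
have mray x : measurable (`]-oo, x]%classic : set R) by [].
have finite (m : {measure set R -> \bar R}) (B : set R) : measurable B ->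
    (m setT < +oo)%E -> (m B < +oo)%E.
  by move=> mB; apply: le_lt_trans; apply: le_measure; rewrite ?inE.
have oinf (m : {measure set R -> \bar R}) x : (m setT < +oo)%E ->
    m `]x, +oo[%classic = (m setT - m `]-oo, x]%classic)%E.
  move=> mfin; rewrite -setCitvl -setTD measureD// setTI//.
apply: (@measure_unique _ R R (@RGenOInfty.G R) g _ _ _ _ m1 m2 _ _ A mA) => //.
- exact: RGenOInfty.measurableE.
- move=> _ _ [x ->] [y ->]; exists (Num.max x y).
  by apply/seteqP; split => z; rewrite /= !in_itv /= !andbT gt_max; [move=> [-> ->]|move=> /andP[]].
- by move=> n; exists (- n%:R).
- apply/seteqP; split => // x _; exists (Num.truncn `|x|).+1 => //.
  rewrite /g /= in_itv/= andbT ltrNl.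
  by apply: le_lt_trans (truncnS_gt _); rewrite -normrN ler_norm.
- by move=> B [x ->]; rewrite !oinf -?e// rays.
- by move=> n; apply: (finite m1 (g n)) => //; exact: measurable_itv.
Qed.

End ray_uniqueness.

(** * The uniform law on the unit interval *)

Section uniform.
Context (R : realType).

(* [uniform_prob] lives on [measurableTypeR R], whose display is not that of [R]. *)
Definition borel_id : measurableTypeR R -> R := idfun.

Let measurable_borel_id : measurable_fun setT borel_id.
Proof. exact: measurable_id. Qed.

HB.instance Definition _ := isMeasurableFun.Build _ _ _ _ borel_id measurable_borel_id.

Definition unit_prob : probability R R :=
  distribution (uniform_prob (@ltr01 R)) borel_id.

Definition unit_measure : {measure set R -> \bar R} := unit_prob.
Local Notation U := unit_measure.

(** This is the distribution function of the uniform law. *)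
Definition clamp (x : R) : R := Num.max 0 (Num.min x 1).

Lemma uniform_ray x : U `]-oo, x]%classic = (clamp x)%:E.
Proof.
rewrite -[LHS]/(uniform_prob (@ltr01 R) `]-oo, x]%classic) /uniform_prob integral_uniform_pdf.
rewrite (eq_integral (cst 1%E)); last first.
  by move=> y; rewrite inE => -[_ /=]; rewrite in_itv/= /uniform_pdf => ->; rewrite subr0 invr1.
rewrite integral_cst//; last exact: measurableI.
rewrite mul1e (_ : _ `&` _ = `[0, Num.min x 1]%classic); last first.
  by apply/seteqP; split => y; rewrite /= !in_itv /= le_min;
    [move=> [-> /andP[-> ->]]|move=> /and3P[-> -> ->]].
transitivity (@lebesgue_measure R `[0, Num.min x 1]%classic) => //.
rewrite lebesgue_measure_itv /= lte_fin /clamp; set m := Num.min x 1.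
have [m0|m0] := ltP 0 m; first by rewrite sube0; congr (_%:E); apply/esym/max_idPr/ltW.
by congr (_%:E); apply/esym/max_idPl.
Qed.

Lemma uniform_setT : U setT = 1%E.
Proof. exact: (probability_setT unit_prob). Qed.

Lemma clamp01 x : 0 <= clamp x <= 1.
Proof. by rewrite /clamp le_max lexx /= ge_max ler01 ge_min lexx orbT. Qed.

Lemma clamp_le0 x : x <= 0 -> clamp x = 0.
Proof.
by move=> x0; rewrite /clamp (min_idPl _) ?(le_trans x0)//; apply/max_idPl.
Qed.

Lemma clamp_ge1 x : 1 <= x -> clamp x = 1.
Proof. by move=> x1; rewrite /clamp (min_idPr _)//; apply/max_idPr. Qed.

Lemma clampE x : 0 <= x <= 1 -> clamp x = x.
Proof. by case/andP => x0 x1; rewrite /clamp (min_idPl _)//; apply/max_idPr. Qed.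

(** Self-similarity of the uniform law, read on its distribution function. *)
Lemma clamp_dyadic x : clamp x = 2^-1 * clamp (2 * x) + 2^-1 * clamp (2 * x - 1).
Proof.
have [x0|x0] := leP x 0; first by rewrite !clamp_le0 ?mulr0 ?addr0//; lra.
have [x1|x1] := leP 1 x; first by rewrite !clamp_ge1; lra.
have [xh|xh] := leP x 2^-1.
  rewrite (@clampE x) ?(@clampE (2 * x)) ?(@clamp_le0 (2 * x - 1)); lra.
rewrite (@clampE x) ?(@clamp_ge1 (2 * x)) ?(@clampE (2 * x - 1)); lra.
Qed.

Lemma uniform_point x : U [set x] = 0%E.
Proof.
rewrite -[LHS]/(uniform_prob (@ltr01 R) [set x]).
have /null_content_dominatesP dom := dominates_uniform_prob (@ltr01 R).
by apply: dom; [exact: measurable_set1|exact: lebesgue_measure_set1].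
Qed.

(** The law charges only the open unit interval, its endpoints being null; digits and quantiles are
    controlled only there. *)
Lemma uniform_ae_eq (A B : set R) : measurable A -> measurable B ->
  (forall u, 0 < u < 1 -> A u <-> B u) -> U A = U B.
Proof.
move=> mA mB AB; pose I : set R := `]0, 1[%classic.
have mI : measurable I by exact: measurable_itv.
have UU (C D : set R) : measurable C -> measurable D -> C `&` D = set0 ->
    U (C `|` D) = (U C + U D)%E by move=> *; exact: measureU.
have UI1 : U I = 1%E.
  have e : `]-oo, 1]%classic = `]-oo, 0]%classic `|` (I `|` [set 1]).
    apply/seteqP; split => y; rewrite /I /= !in_itv /=; last by case=> [|[|->]]; lra.
    move=> y1; have [y0|y0] := leP y 0; [by left|right].
    by have [y2|y2] := ltP y 1; [left|right]; lra.
  have := uniform_ray 1; rewrite e UU//; last 2 first.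
  - exact: measurableU.
  - by apply/seteqP; split => // y {e}; rewrite /I /= !in_itv /= => -[y0 [|y1]]; lra.
  rewrite (UU _ _ mI (measurable_set1 1)); last first.
    by apply/seteqP; split => // y {e}; rewrite /I /= in_itv /= => -[+ y1]; lra.
  by rewrite !uniform_ray clamp_le0// clamp_ge1// uniform_point add0e adde0.
have UI : U (~` I) = 0%E.
  have : (1 + U (~` I) = 1)%E.
    rewrite -UI1 -UU// ?setUv ?setICr//; last exact: measurableC.
    by rewrite uniform_setT UI1.
  have : U (~` I) \is a fin_num.
    rewrite ge0_fin_numE//; apply: (@le_lt_trans _ _ 1%E); last exact: ltry.
    rewrite -uniform_setT; apply: le_measure; rewrite ?inE//; exact: measurableC.
  case: (U _) => [r| |]//= _ /eqP.
  by rewrite -EFinD eqe => /eqP h; congr (_%:E); lra.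
have key (D : set R) : measurable D -> U D = U (D `&` I).
  move=> mD; rewrite -[in LHS](setIT D) -(setUv I) setIUr UU//.
  - rewrite [X in (_ + X)%E](_ : _ = 0%E) ?adde0//.
    apply/eqP; rewrite eq_le measure_ge0 andbT -UI; apply: le_measure; rewrite ?inE//.
    + by apply: measurableI => //; exact: measurableC.
    + exact: measurableC.
  - exact: measurableI.
  - by apply: measurableI => //; exact: measurableC.
  - by rewrite setIACA setICr setI0.
rewrite key// [RHS]key//; congr (U _); apply/seteqP.
by split => u [h /[dup] ui]; rewrite /I /= in_itv /= => /AB e; split => //; apply/e.
Qed.

(** On left rays this is [clamp_dyadic], and rays determine a finite measure. It amounts to
    conditioning on the first binary digit. *)
Lemma uniform_half (A : set R) : measurable A ->
  U A = (2^-1%:E * U [set v | A (v / 2)%R] + 2^-1%:E * U [set v | A ((1 + v) / 2)%R])%E.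
Proof.
have h0 : (0 <= 2^-1 :> R) by lra.
have mf0 : measurable_fun setT (fun v : R => v / 2) by exact: measurable_funM.
have mf1 : measurable_fun setT (fun v : R => (1 + v) / 2).
  by apply: measurable_funM => //; exact: measurable_funD.
have [m0 m0E] := image_measure U mf0; have [m1 m1E] := image_measure U mf1.
have [n0 n0E] := scaled_measure m0 h0; have [n1 n1E] := scaled_measure m1 h0.
have [m mE] := sum_measure n0 n1.
move=> mA; transitivity (m A); last by rewrite mE n0E n1E m0E m1E.
apply: (@measure_ray_unique R U m) => //.
- by rewrite uniform_setT ltry.
- rewrite mE n0E n1E m0E m1E !preimage_setT uniform_setT !mule1.
  by rewrite -EFinD; congr (_%:E); lra.
- move=> x; rewrite mE n0E n1E m0E m1E.
  rewrite (_ : _ @^-1` _ = `]-oo, 2 * x]%classic); last first.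
    by apply/seteqP; split => y; rewrite /= !in_itv/=; lra.
  rewrite (_ : (fun v : R => (1 + v) / 2) @^-1` _ = `]-oo, 2 * x - 1]%classic); last first.
    by apply/seteqP; split => y; rewrite /= !in_itv/=; lra.
  by rewrite !uniform_ray -!EFinM -EFinD -clamp_dyadic.
Qed.

End uniform.

(** * Binary digits of a uniform variable *)

Section digits.
Context (R : realType).
Local Notation U := (@unit_measure R).
Implicit Types u v x y : R.

(** The strict inequality gives 1/2 the expansion ending in ones, so that [doubling] maps ]0, 1]
    into itself. *)
Definition bit u : R := if 2^-1 < u then 1 else 0.
Definition doubling u : R := 2 * u - bit u.

(** Places are counted from 0: each round uses one digit and drops two, and the digit at place 2k
    gets weight 2^-(k+1). *)
Fixpoint even_digits_sum n u : R :=
  if n is m.+1 then (bit u + even_digits_sum m (doubling (doubling u))) / 2 else 0.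

(* The reals whose binary digits are the digits of [u] at even, resp. odd, places. *)
Definition even_digits u : R := limn (even_digits_sum ^~ u).
Definition odd_digits u : R := even_digits (doubling u).

Lemma bit01 u : 0 <= bit u <= 1.
Proof. by rewrite /bit; case: ifP; lra. Qed.

Lemma even_digits_sum01 n u : 0 <= even_digits_sum n u <= 1.
Proof.
elim: n u => [|n ih] u /=; first by rewrite lexx ler01.
by have := ih (doubling (doubling u)); have := bit01 u; lra.
Qed.

Lemma cvg_even_digits u : even_digits_sum ^~ u @ \oo --> even_digits u.
Proof.
apply: nondecreasing_is_cvgn.
  apply/nondecreasing_seqP => n; elim: n u => [|n ih] u.
    by have /andP[] := even_digits_sum01 1 u.
  by have := ih (doubling (doubling u)) => /=; lra.
by exists 1 => _ [n _ <-]; case/andP: (even_digits_sum01 n u).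
Qed.

Lemma even_digits01 u : 0 <= even_digits u <= 1.
Proof.
apply/andP; split.
  by apply: limr_ge; [exact: cvg_even_digits|apply: nearW => n; case/andP: (even_digits_sum01 n u)].
by apply: limr_le; [exact: cvg_even_digits|apply: nearW => n; case/andP: (even_digits_sum01 n u)].
Qed.

(** Limit of the defining recursion: once the first digit is dropped, the remaining even places of u
    are the odd places of [doubling u]. *)
Lemma even_digitsE u : even_digits u = (bit u + odd_digits (doubling u)) / 2.
Proof.
apply: (@cvg_lim R) => //; rewrite -(cvg_shiftS (even_digits_sum ^~ u)) /=.
apply: cvgMl; apply: cvgD; first exact: cvg_cst.
exact: cvg_even_digits.
Qed.

Lemma measurable_bit : measurable_fun setT bit.
Proof. by apply: measurable_fun_ifT => //; exact: measurable_fun_ltr. Qed.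

Lemma measurable_doubling : measurable_fun setT doubling.
Proof.
by apply: measurable_funB; [exact: measurable_funM|exact: measurable_bit].
Qed.

Lemma measurable_even_digits : measurable_fun setT even_digits.
Proof.
apply: (measurable_fun_cvg (h := even_digits_sum)); last first.
  by move=> u _; exact: cvg_even_digits.
elim => [|n ih] //=; apply: measurable_funM => //.
apply: measurable_funD; first exact: measurable_bit.
apply: (measurableT_comp ih); apply: measurableT_comp; exact: measurable_doubling.
Qed.

Lemma measurable_odd_digits : measurable_fun setT odd_digits.
Proof. exact: measurableT_comp measurable_even_digits measurable_doubling. Qed.

Let below x y := [set u | even_digits u <= x /\ odd_digits u <= y].

Let measurable_below x y : measurable (below x y).
Proof.
apply: measurableI.
- rewrite -[X in measurable X]setTI.
  by apply: measurable_fun_le => //; exact: measurable_even_digits.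
- rewrite -[X in measurable X]setTI.
  by apply: measurable_fun_le => //; exact: measurable_odd_digits.
Qed.

Let below_fin x y : U (below x y) \is a fin_num.
Proof. exact: (@fin_num_measure _ _ _ (unit_prob R)). Qed.

(** Joint distribution function of the two digit variables; independence amounts to its being a
    product. *)
Let J x y := fine (U (below x y)).

Let J01 x y : 0 <= J x y <= 1.
Proof.
apply/andP; split; first exact: fine_ge0.
rewrite -lee_fin fineK// -(uniform_setT R).
by apply: le_measure; rewrite ?inE.
Qed.

(* Splitting on the first binary digit of [u]. *)
Let J_rec x y : J x y = 2^-1 * J y (2 * x) + 2^-1 * J y (2 * x - 1).
Proof.
apply: EFin_inj; rewrite EFinD !EFinM !fineK// uniform_half//; last first.
congr (_ * _ + _ * _)%E; apply: uniform_ae_eq => //.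
- rewrite -[X in measurable X]setTI.
  have mf : measurable_fun setT (fun v : R => v / 2) by exact: measurable_funM.
  exact: mf (measurable_below x y).
- move=> u /andP[u0 u1].
  have b0 : bit (u / 2) = 0 by rewrite /bit ifF//; apply/negbTE; rewrite -leNgt; lra.
  have d0 : doubling (u / 2) = u by rewrite /doubling b0; lra.
  (* The even part of u / 2 is half the odd part of u, and its odd part is the even part of u: this
     is why the arguments of [J] are swapped. *)
  rewrite /below /= even_digitsE /odd_digits b0 d0 -/(odd_digits u).
  by split => -[]; lra.
- rewrite -[X in measurable X]setTI.
  have mf : measurable_fun setT (fun v : R => (1 + v) / 2).
    by apply: measurable_funM => //; exact: measurable_funD.
  exact: mf (measurable_below x y).
- move=> u /andP[u0 u1].
  have b1 : bit ((1 + u) / 2) = 1 by rewrite /bit ifT//; lra.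
  have d1 : doubling ((1 + u) / 2) = u by rewrite /doubling b1; lra.
  rewrite /below /= even_digitsE /odd_digits b1 d1 -/(odd_digits u).
  by split => -[]; lra.
Qed.

Let J_ge1l x y : 1 <= x -> J x y = J 1 y.
Proof.
move=> x1; rewrite /J; congr (fine (U _)); apply/seteqP.
by split => u [_ ?]; split => //; have /andP[_] := even_digits01 u; lra.
Qed.

Let J_ge1r x y : 1 <= y -> J x y = J x 1.
Proof.
move=> x1; rewrite /J; congr (fine (U _)); apply/seteqP.
by split => u [? _]; split => //; have /andP[_] := even_digits01 (doubling u); rewrite /odd_digits; lra.
Qed.

Let J_lt0l x y : x < 0 -> J x y = 0.
Proof.
move=> x0; rewrite /J (_ : below x y = set0) ?measure0//.
by apply/seteqP; split => // u [h _] /=; have /andP[] := even_digits01 u; lra.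
Qed.

Let J_lt0r x y : y < 0 -> J x y = 0.
Proof.
move=> x0; rewrite /J (_ : below x y = set0) ?measure0//.
by apply/seteqP; split => // u [_ +] /=; have /andP[] := even_digits01 (doubling u); rewrite /odd_digits; lra.
Qed.

Let J11 : J 1 1 = 1.
Proof.
rewrite /J (_ : below 1 1 = setT) ?uniform_setT//.
apply/seteqP; split => // u _; split.
  by case/andP: (even_digits01 u).
by case/andP: (even_digits01 (doubling u)).
Qed.

(** At x = 1 the recursion [J_rec] shows that the two marginals agree, so their common value
    satisfies the dyadic equation of [clamp]. *)
Let J1l_rec y : J y 1 = 2^-1 * J (2 * y) 1 + 2^-1 * J (2 * y - 1) 1.
Proof.
have swap z : J 1 z = J z 1.
  have := J_rec 1 z; have -> : 2 * 1 - 1 = 1 :> R by ring.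
  have -> : J z (2 * 1) = J z 1 by apply: J_ge1r; lra.
  by move=> ->; rewrite -mulrDl -[2^-1]mul1r -splitr mul1r.
by rewrite -(swap (2 * y)) -(swap (2 * y - 1)); exact: J_rec.
Qed.

(** Both sides are bounded and satisfy the same dyadic equation. On either side of 1/2 one of its
    two terms is already known, so the difference at y is half the difference at 2 y - 1 or at 2
    y. *)
Let J1E y : J y 1 = clamp y.
Proof.
apply/eqP; rewrite -subr_eq0; apply/eqP.
apply: (halving_eq0 (d := fun y => J y 1 - clamp y) (b := 1)) => {}y.
  by have := J01 y 1; have := clamp01 y; rewrite ler_norml; lra.
have [yh|yh] := leP 2^-1 y.
  exists (2 * y - 1); rewrite J1l_rec clamp_dyadic.
  rewrite (@J_ge1l (2 * y)) ?J11 ?(@clamp_ge1 _ (2 * y)); [|lra..].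
  rewrite -[2^-1 in leRHS]ger0_norm ?invr_ge0// -normrM.
  by rewrite le_eqVlt; apply/orP; left; apply/eqP; congr `|_|; lra.
exists (2 * y); rewrite J1l_rec clamp_dyadic.
rewrite (@J_lt0l (2 * y - 1)) ?(@clamp_le0 _ (2 * y - 1)); [|lra..].
rewrite -[2^-1 in leRHS]ger0_norm ?invr_ge0// -normrM.
by rewrite le_eqVlt; apply/orP; left; apply/eqP; congr `|_|; lra.
Qed.

(** The same halving argument, now on pairs; the term known in advance comes from the marginal [J1E]
    or vanishes. *)
Let JE x y : J x y = clamp x * clamp y.
Proof.
apply/eqP; rewrite -subr_eq0; apply/eqP.
apply: (halving_eq0 (d := fun z => J z.1 z.2 - clamp z.1 * clamp z.2) (b := 1) _ _ (x, y))
    => -[{}x {}y] /=.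
  have := J01 x y; have := clamp01 x; have := clamp01 y.
  rewrite ler_norml => /andP[? ?] /andP[? ?] /andP[? ?]; apply/andP; split; nra.
have [yh|yh] := leP 2^-1 x.
  exists (y, 2 * x - 1); rewrite /= J_rec (clamp_dyadic x).
  rewrite (@J_ge1r y (2 * x)) ?J1E ?(@clamp_ge1 _ (2 * x)); [|lra..].
  rewrite -[2^-1 in leRHS]ger0_norm ?invr_ge0// -normrM.
  by rewrite le_eqVlt; apply/orP; left; apply/eqP; congr `|_|; lra.
exists (y, 2 * x); rewrite /= J_rec (clamp_dyadic x).
rewrite (@J_lt0r y (2 * x - 1)) ?(@clamp_le0 _ (2 * x - 1)); [|lra..].
rewrite -[2^-1 in leRHS]ger0_norm ?invr_ge0// -normrM.
by rewrite le_eqVlt; apply/orP; left; apply/eqP; congr `|_|; lra.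
Qed.

Lemma digits_rays x y :
  U (even_digits @^-1` `]-oo, x]%classic `&` odd_digits @^-1` `]-oo, y]%classic) =
  (U `]-oo, x]%classic * U `]-oo, y]%classic)%E.
Proof.
rewrite !uniform_ray -EFinM -JE fineK//.
Qed.

End digits.

(** * Independence of the even and odd digits *)

Section digits_independence.
Context (R : realType).
Local Notation U := (@unit_measure R).
Local Notation X := (@even_digits R).
Local Notation Y := (@odd_digits R).

(** For fixed D both sides are finite measures in A that agree on left rays. It is used once for
    each of the two digit variables. *)
Let independent_of_ray (Z : R -> R) (D : set R) (c : R) :
  measurable_fun setT Z -> (forall u, Z u <= 1) -> measurable D -> 0 <= c ->
  (forall x, U (Z @^-1` `]-oo, x]%classic `&` D) = (U `]-oo, x]%classic * c%:E)%E) ->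
  forall A, measurable A -> U (Z @^-1` A `&` D) = (U A * c%:E)%E.
Proof.
move=> mZ Z1 mD c0 rays A mA.
have [m1 m1E] := restricted_measure U mD.
have [m2 m2E] := image_measure m1 mZ.
have [m3 m3E] := scaled_measure U c0.
(* Since Z <= 1, the ray ending at 1 already carries the total mass. *)
have m2T : m2 setT = c%:E.
  rewrite m2E m1E preimage_setT; have := rays 1.
  rewrite uniform_ray clamp_ge1// mul1e => <-; congr (U (_ `&` _)).
  by apply/seteqP; split => u //= _; rewrite in_itv/=; exact: Z1.
rewrite muleC -m3E -m1E -m2E; apply: measure_ray_unique => //.
- by rewrite m2T ltry.
- by rewrite m2T m3E uniform_setT mule1.
- by move=> x; rewrite m2E m1E rays m3E muleC.
Qed.

Lemma digits_independent (A B : set R) : measurable A -> measurable B ->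
  U (X @^-1` A `&` Y @^-1` B) = (U A * U B)%E.
Proof.
move=> mA mB.
have mpre (Z : R -> R) (C : set R) : measurable_fun setT Z -> measurable C ->
    measurable (Z @^-1` C).
  by move=> mZ mC; rewrite -[X in measurable X]setTI; exact: mZ.
have mX := @measurable_even_digits R; have mY := @measurable_odd_digits R.
have fin C : measurable C -> U C \is a fin_num.
  by move=> mC; exact: (@fin_num_measure _ _ _ (unit_prob R)).
have half x C : measurable C ->
    U (X @^-1` C `&` Y @^-1` `]-oo, x]%classic) = (U C * U `]-oo, x]%classic)%E.
  move=> mC; rewrite uniform_ray; apply: independent_of_ray => //.
  - by move=> u; have /andP[] := even_digits01 u.
  - exact: mpre.
  - by case/andP: (clamp01 x).
  - by move=> y; rewrite -(uniform_ray x); exact: digits_rays.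
rewrite setIC muleC -(fineK (fin _ mA)); apply: independent_of_ray => //.
- by move=> u; have /andP[] := even_digits01 (doubling u).
- exact: mpre.
- by move=> x; rewrite setIC half// muleC fineK//; exact: fin.
Qed.

(** By independence the joint law of the digit variables agrees with the product measure on
    rectangles, hence on all measurable sets; writing both as mixtures of Dirac masses extends this
    to functions. *)
Lemma integral_digits (f : R * R -> \bar R) : measurable_fun setT f ->
  (forall z, (0 <= f z)%E) ->
  (\int[unit_prob R]_v f (X v, Y v) =
   \int[unit_prob R]_x \int[unit_prob R]_y f (x, y))%E.
Proof.
move=> mf f0.
have mXY : measurable_fun setT (fun v => (X v, Y v)).
  apply: measurable_fun_pair; first exact: measurable_even_digits.
  exact: measurable_odd_digits.
have [m' m'E] := image_measure (unit_prob R) mXY.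
transitivity (\int[(unit_prob R) \x (unit_prob R)]_z f z)%E; last exact: fubini_tonelli1.
transitivity (\int[unit_prob R]_v \int[\d_(X v, Y v)]_z f z)%E.
  by apply: eq_integral => v _; rewrite integral_dirac// diracT mul1e.
transitivity (\int[(unit_prob R) \x (unit_prob R)]_u \int[\d_u]_z f z)%E; last first.
  by apply: eq_integral => v _; rewrite integral_dirac// diracT mul1e.
apply: eq_integral_mixture => //.
- by move=> B mB; apply: (measurableT_comp (measurable_fun_dirac mB)).
- by move=> B mB; exact: measurable_fun_dirac.
move=> B mB; transitivity (m' B).
  rewrite m'E -[in RHS](setIT (_ @^-1` _)) -integral_indic//.
  by rewrite -[X in measurable X]setTI; exact: mXY.
transitivity (((unit_prob R) \x (unit_prob R))%E B); last first.
  transitivity (\int[(unit_prob R) \x (unit_prob R)]_z (\1_B z)%:E)%E => //.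
  by rewrite integral_indic// setIT.
apply/esym/product_measure_unique => // C D mC mD.
rewrite m'E -[RHS]digits_independent//.
Qed.

End digits_independence.

(** * Quantile function of a law on the line *)

Section quantile.
Context (R : realType) (mu : {measure set R -> \bar R}).
Hypothesis mu1 : mu setT = 1%E.

(* Carries the probability instance needed to apply the lemmas on [cdf]. *)
Definition mu_copy : set R -> \bar R := mu.
HB.instance Definition _ := Measure.copy mu_copy mu.
HB.instance Definition _ := Measure_isProbability.Build _ _ _ mu_copy mu1.
(** The identity, packaged as a random variable so that its [cdf] is the mass of left rays. *)
Definition real_id : R -> R := id.
HB.instance Definition _ :=
  @isMeasurableFun.Build _ _ _ _ real_id (@measurable_id _ _ setT).
Let Z : {RV mu_copy >-> R} := real_id.

Definition ray_mass (x : R) : R := fine (mu `]-oo, x]%classic).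

(** Generalized inverse of the distribution function. Outside ]0, 1[ the set may be empty or
    unbounded below, and the default value is 0. *)
Definition quantile (u : R) : R :=
  if (0 < u < 1) then inf [set x | u <= ray_mass x] else 0.

Let ray_mass_nd x y : x <= y -> ray_mass x <= ray_mass y.
Proof.
move=> xy; apply: fine_le; rewrite ?(@fin_num_measure _ _ _ mu_copy)//.
exact: cdf_nondecreasing Z _ _ xy.
Qed.

Let ray_mass_y : ray_mass @ +oo --> (1 : R).
Proof. exact: fine_cvg (cvg_cdfy1 Z). Qed.

Let ray_mass_Ny : ray_mass @ -oo --> (0 : R).
Proof. exact: fine_cvg (cvg_cdfNy0 Z). Qed.

Let ray_mass_right x : ray_mass @ x^'+ --> ray_mass x.
Proof.
apply: fine_cvg; rewrite /ray_mass fineK ?(@fin_num_measure _ _ _ mu_copy)//.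
exact: (@cdf_right_continuous _ _ _ _ Z x).
Qed.

(** The limits at infinity make the set nonempty and bounded below, and right continuity makes its
    infimum attained. *)
Lemma quantile_le u x : 0 < u < 1 -> (quantile u <= x) = (u <= ray_mass x).
Proof.
move=> u01; rewrite /quantile u01; have /andP[u0 u1] := u01.
set E := [set x | _].
have E0 : E !=set0.
  have : \forall x \near +oo, u < ray_mass x by exact: (cvgr_gt _ ray_mass_y).
  by move=> /filter_ex [y /ltW]; exists y.
have Elb : has_lbound E.
  have : \forall x \near -oo, ray_mass x < u by exact: (cvgr_lt _ ray_mass_Ny).
  move=> /filter_ex [y yu]; exists y => z Ez; rewrite leNgt; apply/negP => /ltW/ray_mass_nd.
  by move=> /le_lt_trans/(_ yu); rewrite ltNge Ez.
have infE : u <= ray_mass (inf E).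
  apply: (cvgr_to_ge (F := (inf E)^'+) (f := ray_mass)) => //.
  near=> y.
  have : inf E < y by near: y; exact: nbhs_right_gt.
  move=> /inf_lt[//|z Ez zy].
  exact: le_trans Ez (ray_mass_nd (ltW zy)).
apply/idP/idP => [h|h]; first exact: le_trans infE (ray_mass_nd h).
exact: ge_inf.
Unshelve. all: by end_near. Qed.

End quantile.

(** * Existence of a chain with a given kernel on the line *)

Section chain_existence.
Context (R : realType) (K : R -> {measure set R -> \bar R}).
Hypothesis mK : forall B, measurable B -> measurable_fun setT (K ^~ B).
Hypothesis K1 : forall w, K w setT = 1%E.

Let q (z : R * R) := quantile (K z.1) z.2.

Let q_le z x : (q z <= x) =
  if 0 < z.2 < 1 then z.2 <= ray_mass (K z.1) x else 0 <= x.
Proof. by rewrite /q; case: ifP => z01; [exact: quantile_le|rewrite /quantile z01]. Qed.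

(** Joint measurability is checked on the sets where q <= x, which [q_le] describes through
    measurable functions of each coordinate. *)
Let measurable_q : measurable_fun setT q.
Proof.
have mle x : measurable_fun setT (fun z => q z <= x).
  under eq_fun do rewrite q_le.
  apply: measurable_fun_ifT => //.
  - by apply: measurable_and; apply: measurable_fun_ltr => //; exact: measurable_snd.
  - apply: measurable_fun_ler; first exact: measurable_snd.
    apply: (measurableT_comp (f := fun w => ray_mass (K w) x)); last exact: measurable_fst.
    by apply: measurableT_comp => //; exact: mK.
apply: (measurability _ (RGenOInfty.measurableE R)) => _ [_ [x ->] <-].
rewrite setTI (_ : _ @^-1` _ = (fun z => q z <= x) @^-1` [set false]).
  by rewrite -[X in measurable X]setTI; exact: mle.
apply/seteqP; split => z; rewrite /= in_itv /= andbT ltNge; first by move=> /negbTE.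
by move=> ->.
Qed.

Let measurable_q_section w : measurable_fun setT (fun u => q (w, u)).
Proof. exact: (measurableT_comp measurable_q (pair1_measurable w)). Qed.

(** Inverse transform sampling: on a left ray the event is u <= [ray_mass (K w) x], up to null
    sets. *)
Let law_q w B : measurable B -> unit_prob R [set u | B (q (w, u))] = K w B.
Proof.
move=> mB; have [m mE] := image_measure (@unit_measure R) (measurable_q_section w).
transitivity (m B); first by rewrite mE.
apply: measure_ray_unique => //.
- by rewrite mE preimage_setT uniform_setT ltry.
- by rewrite mE preimage_setT uniform_setT K1.
- move=> x; rewrite mE.
  have fin : K w `]-oo, x]%classic \is a fin_num.
    exact: (@fin_num_measure _ _ _ (mu_copy (K w))).
  transitivity (@unit_measure R `]-oo, ray_mass (K w) x]%classic).
    apply: uniform_ae_eq => //.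
      by rewrite -[X in measurable X]setTI; exact: measurable_q_section.
    by move=> u u01; rewrite /= !in_itv /= q_le /= u01.
  rewrite uniform_ray clampE /ray_mass ?fineK//.
  apply/andP; split; first exact: fine_ge0.
  by rewrite -lee_fin fineK// -(K1 w); apply: le_measure; rewrite ?inE.
Qed.

Lemma markov_chain_exists w0 : exists (dO : measure_display) (Om : measurableType dO)
  (Pr : probability Om R) (W : nat -> Om -> R), mc_realization Pr K w0 W.
Proof.
exists _, R, (unit_prob R), (fun n om => (split_chain (@even_digits R) (@odd_digits R) q w0 n om).1).
apply: split_chain_realization => //.
- exact: measurable_even_digits.
- exact: measurable_odd_digits.
- exact: integral_digits.
Qed.

End chain_existence.

(** * The lumped chain *)

Section lumping.
Context dX dT (X : measurableType dX) (Theta : measurableType dT) (R : realType).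
Variables (P : R.-pker Theta ~> X) (Q : R.-pker X ~> Theta).
Variables (nu : {measure set Theta -> \bar R}) (M : {measure set X -> \bar R}).
Hypothesis PQ : forall f : X * Theta -> \bar R, measurable_fun setT f ->
  (forall z, 0 <= f z)%E ->
  (\int[nu]_th \int[P th]_x f (x, th) = \int[M]_x \int[Q x]_th f (x, th))%E.
Variables (t : Theta -> R) (s : {measure set R -> \bar R}).
Hypotheses (mt : measurable_fun setT t) (t0 : forall th, 0 <= t th).
Hypothesis sE : forall A, measurable A -> s A = nu (t @^-1` A).
Variables (pi : R.-pker R ~> Theta) (tP : R.-pker R ~> X) (tQ : R.-pker X ~> R).
Hypothesis piE : forall (f1 : Theta -> \bar R) (f2 : R -> \bar R),
  measurable_fun setT f1 -> measurable_fun setT f2 ->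
  (forall th, 0 <= f1 th)%E -> (forall a, 0 <= f2 a)%E ->
  (\int[nu]_th (f2 (t th) * f1 th)
   = \int[s]_(a in `[0%R, +oo[%classic) (f2 a * \int[pi a]_th f1 th))%E.
Hypothesis tPE : forall a B, measurable B -> tP a B = (\int[pi a]_th P th B)%E.
Hypothesis tPQ : forall f : X * R -> \bar R, measurable_fun setT f ->
  (forall z, 0 <= f z)%E ->
  (\int[s]_a \int[tP a]_x f (x, a) = \int[M]_x \int[tQ x]_a f (x, a))%E.

(** As t >= 0, the negative half-line is null for [s]. *)
Let integral_s (f : R -> \bar R) : measurable_fun setT f -> (forall a, 0 <= f a)%E ->
  (\int[s]_(a in `[0%R, +oo[%classic) f a = \int[s]_a f a)%E.
Proof.
move=> mf f0; set D : set R := `[0%R, +oo[%classic.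
have mD : measurable D by exact: measurable_itv.
rewrite [RHS](ge0_negligible_integral (N := ~` D))//.
- by rewrite setTD setCK.
- exact: measurableC.
- rewrite sE; last exact: measurableC.
  rewrite (_ : _ @^-1` _ = set0) ?measure0//.
  by apply/seteqP; split => // th; apply; rewrite /D /= in_itv /= andbT; exact: t0.
Qed.

Lemma ge0_integral_lump (f : R -> R) : ufun f ->
  (\int[nu]_th (f (t th))%:E = \int[s]_a (f a)%:E)%E.
Proof.
move=> uf; have mf : measurable_fun setT (EFin \o f) by apply/measurable_EFinP; case: uf.
have f0 a : (0 <= (EFin \o f) a)%E by rewrite lee_fin; case/andP: (uf.2 a).
have := piE (measurable_cst 1%E) mf (fun=> lee01) f0 => /=.
under [in LHS]eq_integral do rewrite mule1.
move=> ->; rewrite -integral_s//; apply: eq_integral => a _.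
by rewrite integral_cst// prob_kernel !mule1.
Qed.

Lemma ufun_lump (f : R -> R) : ufun f -> ufun (f \o t).
Proof. by move=> [mf f01]; split; [exact: measurableT_comp|move=> th; exact: f01]. Qed.

Lemma kmean_lump (phi : X -> R) a : ufun phi -> kmean tP phi a = kmean pi (kmean P phi) a.
Proof.
move=> up; apply: EFin_inj; rewrite !kmeanE//; last exact: ufun_kmean.
rewrite (ge0_integral_mixture (mu := pi a) (k := P))//.
- by apply: eq_integral => th _; rewrite kmeanE.
- exact: measurable_kernel.
- by move=> B mB; exact: tPE.
- by apply/measurable_EFinP; case: up.
- by move=> z; rewrite lee_fin; case/andP: (up.2 z).
Qed.

(** A weak form of the identity between [kmean tQ h] and [kmean Q (h \o t)]. By adjointness both
    kernels move onto phi; then [piE] applies to h and [kmean P phi], because [tP] is [pi] followed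
    by [P]. *)
Lemma integral_kmean_lump (phi : X -> R) (h : R -> R) : ufun phi -> ufun h ->
  (\int[M]_x (phi x * kmean tQ h x)%:E = \int[M]_x (phi x * kmean Q (h \o t) x)%:E)%E.
Proof.
move=> up uh; rewrite -(ge0_kmean_adjoint tPQ)// -(ge0_kmean_adjoint PQ)//; last exact: ufun_lump.
have uP := ufun_kmean P up; have upi := ufun_kmean pi uP.
have mP : measurable_fun setT (EFin \o kmean P phi) by apply/measurable_EFinP; case: uP.
have P0 th : (0 <= (EFin \o kmean P phi) th)%E by rewrite lee_fin; case/andP: (uP.2 th).
have mh : measurable_fun setT (EFin \o h) by apply/measurable_EFinP; case: uh.
have h0 a : (0 <= (EFin \o h) a)%E by rewrite lee_fin; case/andP: (uh.2 a).
under [RHS]eq_integral do rewrite EFinM.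
rewrite [RHS](piE mP mh P0 h0).
have uhpi := ufunM uh upi.
rewrite -[LHS]integral_s.
- by apply: eq_integral => a _; rewrite kmean_lump// EFinM kmeanE.
- apply/measurable_EFinP; apply: measurable_funM; first by case: uh.
  by case: (ufun_kmean tP up).
- move=> a; rewrite lee_fin mulr_ge0//; first by case/andP: (uh.2 a).
  by case/andP: ((ufun_kmean tP up).2 a).
Qed.

(** The weak identity is tested with [kmean tQ h], then with [kmean Q (h \o t)]. *)
Lemma lump_norm (h : R -> R) : ufun h ->
  \int[M]_x (kmean tQ h x ^+ 2) = \int[M]_x (kmean Q (h \o t) x ^+ 2).
Proof.
move=> uh; have uQ := ufun_kmean tQ uh; have uQt := ufun_kmean Q (ufun_lump uh).
rewrite /Rintegral; congr fine.
transitivity (\int[M]_x (kmean tQ h x * kmean Q (h \o t) x)%:E)%E.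
  by rewrite -integral_kmean_lump.
under eq_integral do rewrite mulrC.
by rewrite integral_kmean_lump.
Qed.

Lemma ufun1_lump h : ufun1 s h -> ufun1 nu (h \o t).
Proof.
move=> [uh ih]; have ut := ufun_lump uh; split => //.
apply/integrableP; split; first by apply/measurable_EFinP; case: ut.
under eq_integral.
  by move=> x _; rewrite gee0_abs ?lee_fin; [over|case/andP: (ut.2 x)].
rewrite [X in (X < _)%E]ge0_integral_lump//.
exact: (integrable_lty measurableT ih).
Qed.

Variable B : set R.
Hypothesis mB : measurable B.
Hypothesis sB : (s B < +oo)%E.

Let may_escape w0 := exists (dO : measure_display) (Om : measurableType dO)
    (Pr : probability Om R) (W : nat -> Om -> R),
  mc_realization Pr (fun b C => \int[tP b]_x tQ x C)%E w0 W /\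
  (Pr (hit_event W B) < 1)%E.

Hypothesis Brec : s.-negligible [set w0 | B w0 /\ may_escape w0].

(** The assumption constrains all realizations from w0; it yields a limit because at least one
    realization exists. *)
Let nohit_cvg w0 : ~ may_escape w0 ->
  ((nohit tP tQ B n w0)%:E @[n --> \oo] --> 0)%E.
Proof.
move=> no.
have K1 w : mkcomp_noparam tP tQ w setT = 1%E.
  transitivity (\int[tP w]_x (cst 1%E x))%E.
    by apply: eq_integral => x _; exact: prob_kernel.
  by rewrite integral_cst// prob_kernel mule1.
have mK C : measurable C -> measurable_fun setT ((mkcomp_noparam tP tQ) ^~ C).
  exact: measurable_kernel.
have [dO [Om [Pr [W WK]]]] := markov_chain_exists mK K1 w0.
apply: (nohit_cvg0 WK mB); rewrite leNgt; apply/negP => lt1.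
by apply: no; exists dO, Om, Pr, W.
Qed.

(** Dominated convergence under the indicator of B, the integrand tending to 0 off the negligible
    set of [Brec]. *)
Let escape_cvg : (\int[s]_a (\1_B a * nohit tP tQ B n a)%:E @[n --> \oo] --> 0)%E.
Proof.
have [N [mN N0 subN]] := Brec.
have uB n := ufun1_escape tP tQ mB sB n.
have mu_ n : measurable_fun setT (fun a => (\1_B a * nohit tP tQ B n a)%:E).
  by apply/measurable_EFinP; case: (uB n).1.
have cvg0 : {ae s, forall a, setT a ->
    (\1_B a * nohit tP tQ B n a)%:E @[n --> \oo] --> (cst 0%E a : \bar R)}.
  exists N; split => // a na; apply: subN; apply: contrapT => nb; apply: na => _.
  have [Ba|nBa] := pselect (B a).
    rewrite indicE mem_set//=; under eq_fun do rewrite mul1r.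
    by apply: nohit_cvg => esc; exact: nb.
  by rewrite indicE memNset//=; under eq_fun do rewrite mul0r; exact: cvg_cst.
have dom : {ae s, forall a n, setT a ->
    (`|(\1_B a * nohit tP tQ B n a)%:E| <= (\1_B a)%:E)%E}.
  apply: aeW => a n _; rewrite gee0_abs ?lee_fin; last by case/andP: ((uB n).1.2 a).
  by rewrite ler_piMr// ?indicE//; case/andP: ((ufun_nohit tP tQ mB n).2 a).
have [_ i1] := ufun1_indic mB sB.
have [_ _] := dominated_convergence measurableT mu_ (measurable_cst 0%E) cvg0 i1 dom.
by rewrite integral0.
Qed.

(** The function is h_n o t for the lumped chain. Its norms equal those of h_n, so its energy is
    bounded by the escape integral of B, which tends to 0. *)
Lemma recurrent_lump_capacity0 delta : 0 < delta -> exists g,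
  [/\ ufun1 nu g, (forall th, (t @^-1` B) th -> g th = 1) &
      \int[nu]_th (g th ^+ 2) <= \int[M]_x (kmean Q g x ^+ 2) + delta].
Proof.
move=> d0.
have uB n := (ufun1_escape tP tQ mB sB n).
(* The index is a successor because [hit_energy] bounds the energy of h_n by the escape integral at
   n + 1. *)
have [n nd] : exists n, \int[s]_a (\1_B a * nohit tP tQ B n.+1 a) <= delta.
  have : \forall n \near \oo, \int[s]_a (\1_B a * nohit tP tQ B n a) < delta.
    by apply: (cvgr_lt 0) => //; exact: fine_cvg escape_cvg.
  case=> m _ /(_ m.+1 (leqnSn m)) /ltW h; by exists m.
have h1 := ufun1_hit mB tPQ sB n.
exists (hit tP tQ B n \o t); split.
- exact: ufun1_lump.
- by move=> th Bth; exact: hit_in.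
- rewrite -lump_norm; last exact: h1.1.
  have := hit_energy mB tPQ sB n.
  rewrite (_ : \int[nu]_th _ = \int[s]_a (hit tP tQ B n a ^+ 2)); first lra.
  rewrite /Rintegral -ge0_integral_lump//; exact: (ufun1_sqr h1).1.
Qed.

End lumping.

(** * Transfer of recurrence from the lumped chain to the original one *)

Local Open Scope ereal_scope.
Theorem theorem3p4 (R : realType)
  (dX dT : measure_display) (X : measurableType dX) (Theta : measurableType dT)
  (HX : @polish_borel R _ X) (HTheta : @polish_borel R _ Theta)
  (P : R.-pker Theta ~> X)
  (nu : {measure set Theta -> \bar R}) (Hnu : sigma_finite setT nu)
  (M : {measure set X -> \bar R})
  (HM : forall B, measurable B -> M B = \int[nu]_th P th B)
  (HMs : sigma_finite setT M)
  (Q : R.-pker X ~> Theta)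
  (HQ : forall f : (X * Theta)%type -> \bar R, measurable_fun setT f ->
     (forall z, 0 <= f z) ->
     \int[nu]_th \int[P th]_x f (x, th) = \int[M]_x \int[Q x]_th f (x, th))
  (t : Theta -> R) (Ht : measurable_fun setT t) (Ht0 : forall th, (0 <= t th)%R)
  (s : {measure set R -> \bar R})
  (Hs : forall A, measurable A -> s A = nu (t @^-1` A))
  (A : nat -> set R) (HA : forall i, measurable (A i))
  (HAd : trivIset setT A) (HAc : \bigcup_i A i = `[0%R, +oo[%classic)
  (HApos : forall i, 0 < nu (t @^-1` A i) < +oo)
  (pi : R.-pker R ~> Theta)
  (Hpi : forall (f1 : Theta -> \bar R) (f2 : R -> \bar R),
     measurable_fun setT f1 -> measurable_fun setT f2 ->
     (forall th, 0 <= f1 th) -> (forall a, 0 <= f2 a) ->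
     \int[nu]_th (f2 (t th) * f1 th)
     = \int[s]_(a in `[0%R, +oo[%classic) (f2 a * \int[pi a]_th f1 th))
  (tP : R.-pker R ~> X)
  (HtP : forall a B, measurable B -> tP a B = \int[pi a]_th P th B)
  (tQ : R.-pker X ~> R)
  (HtQ0 : forall x, tQ x `[0%R, +oo[%classic = 1)
  (HtQ : forall f : (X * R)%type -> \bar R, measurable_fun setT f ->
     (forall z, 0 <= f z) ->
     \int[s]_a \int[tP a]_x f (x, a) = \int[M]_x \int[tQ x]_a f (x, a)) :
  locally_recurrent_on (`[0%R, +oo[%classic : set R) s (fun b C => \int[tP b]_x tQ x C) ->
  locally_recurrent_on setT nu (fun eta C => \int[P eta]_x Q x C).
Proof.
move=> rec C _ Cproper; split => //; have [mC _ nuC] := Cproper.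
pose D i : set Theta := t @^-1` A i.
have mD i : measurable (D i) by rewrite -[X in measurable X]setTI; exact: Ht.
have cap i : forall delta : R, (0 < delta)%R -> exists g,
    [/\ ufun1 nu g, (forall th, D i th -> g th = 1%R) &
        (\int[nu]_th (g th ^+ 2) <= \int[M]_x (kmean Q g x ^+ 2) + delta)%R].
  have /andP[A0 Aoo] := HApos i.
  have Asub : A i `<=` `[0%R, +oo[%classic by rewrite -HAc; exact: bigcup_sup.
  have [|_ neg] := rec (A i) Asub; first by split; rewrite ?Hs.
  by apply: (recurrent_lump_capacity0 HQ Ht Ht0 Hs Hpi HtP HtQ (HA i) _ neg); rewrite Hs.
(* Countably many null sets cover the bad points of C: i locates the value of t, and 1 / (j + 1)
   bounds the escape probability from below. *)
pose E i j := C `&` D i `&` [set x | forall n, (j.+1%:R^-1 <= nohit P Q C n x)%R].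
have Enull i j : nu.-negligible (E i j).
  exists (E i j); split => //; first exact: measurable_escaping.
  by apply: (escaping_null HQ mC nuC (mD i) (cap i)); rewrite invr_gt0.
apply: (negligibleS _ (negligible_bigcup (fun i => negligible_bigcup (Enull i)))).
move=> th [Cth [dO [Om [Pr [W [WK lt1]]]]]].
have [eps eps0 low] := nohit_lower_bound WK mC lt1.
have : (\bigcup_i A i) (t th) by rewrite HAc /= in_itv /= andbT.
case=> i _ Ai; exists i => //.
(* The truncation of 1 / eps gives 1 / (j + 1) <= eps. *)
pose j := Num.truncn eps^-1; exists j => //; split; first by split.
move=> n; apply: le_trans (low n).
rewrite -[leRHS]invrK lef_pV2 ?posrE ?invr_gt0//.
exact/ltW/truncnS_gt.
Qed.
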